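(* Let $S\subset\mathbb{R}^n$ be a relatively open piece of a $C^1$ hypersurface and let $f\in C_c(\mathbb{R}^n)$ satisfy $R_Sf=0$. If there is a point $p_0\in S$ such that $\operatorname{supp} f$ lies strictly on one side of the tangent hyperplane $T_{p_0}S$ (i.e. $\operatorname{supp} f$ is contained in one of the open half-spaces bounded by $T_{p_0}S$), then $f\equiv 0$.
   Context: $C_c(\mathbb{R}^n)$ is the space of compactly supported continuous functions. For a continuous function $f$, $Rf(p,r)=\int_{|y-p|=r}f(y)\,d\sigma(y)$ with $d\sigma$ the surface measure on the sphere of radius $r>0$ centered at $p$. ''$R_Sf=0$'' means $Rf(p,r)=0$ for all $p\in S$ and all $r>0$. *)

(* Defs.v *)
From HB Require Import structures.
From mathcomp Require Import all_boot all_order all_algebra.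
From mathcomp Require Import all_classical all_reals all_analysis.
Set Implicit Arguments. Unset Strict Implicit. Unset Printing Implicit Defensive.
Import Order.TTheory GRing.Theory Num.Theory.
Import numFieldNormedType.Exports.
Local Open Scope classical_set_scope.
Local Open Scope ring_scope.

(* Points of R^n are row vectors 'rV[R]_n.  The library norm on 'rV is the
   max norm; it induces the usual topology (used for open/compact/closure and
   differentiability), but spheres must be Euclidean, so we define the
   Euclidean norm explicitly. *)
Definition enorm (R : realType) (n : nat) (x : 'rV[R]_n) : R :=
  Num.sqrt (\sum_(i < n) x ord0 i ^+ 2).

(* Iterated one-dimensional Lebesgue integration, coordinate by coordinate
   (the Lebesgue integral on R^n, via Fubini; there is no n-dimensional
   Lebesgue measure on 'rV in the library). *)
Fixpoint iter_int (R : realType) (k : nat) (G : (nat -> R) -> \bar R) : \bar R :=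
  match k with
  | 0 => G (fun _ => 0)
  | k'.+1 => (\int[@lebesgue_measure R]_t
                 iter_int k' (fun x => G (fun j => if j == k' then t else x j)))%E
  end.

Definition Rn_integral (R : realType) (n : nat) (g : 'rV[R]_n -> \bar R) : \bar R :=
  iter_int n (fun x => g (\row_(i < n) x i)).

(* Surface integral of f over the Euclidean sphere of radius r > 0 centred
   at p, with the surface measure defined by polar coordinates (cone measure):
   sigma_{S^{n-1}}(A) = n * |{t w : 0 < t <= 1, w in A}|, so that
   int_{|y-p|=r} f dsigma = r^(n-1) * n * int_{0<|x|<1} f(p + r x/|x|) dx. *)
Definition sphere_integral (R : realType) (n : nat) (f : 'rV[R]_n -> R)
    (p : 'rV[R]_n) (r : R) : \bar R :=
  (((r ^+ n.-1) *+ n)%:E *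
   Rn_integral (fun x : 'rV[R]_n =>
      if ((0 < enorm x) && (enorm x < 1))%R
      then (f (p + (r / enorm x) *: x)%R)%:E else 0%E))%E.

Definition spherical_transform (R : realType) (n : nat) (f : 'rV[R]_n -> R)
    (p : 'rV[R]_n) (r : R) : \bar R := sphere_integral f p r.

Definition RS_vanishes (R : realType) (n : nat) (S : set 'rV[R]_n)
    (f : 'rV[R]_n -> R) : Prop :=
  forall p r, S p -> 0 < r -> spherical_transform f p r = 0%E.

Definition supp (R : realType) (n : nat) (f : 'rV[R]_n -> R) : set 'rV[R]_n :=
  closure [set x | f x != 0].

Definition Cc (R : realType) (n : nat) (f : 'rV[R]_n -> R) : Prop :=
  continuous f /\ compact (supp f).

Definition C1_on (R : realType) (n : nat) (U : set 'rV[R]_n)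
    (phi : 'rV[R]_n -> R) : Prop :=
  (forall x, U x -> differentiable phi x) /\
  (forall v x, U x -> {for x, continuous (fun y => 'D_v phi y)}).

Definition local_defining (R : realType) (n : nat) (S : set 'rV[R]_n)
    (p : 'rV[R]_n) (U : set 'rV[R]_n) (phi : 'rV[R]_n -> R) : Prop :=
  [/\ open U, U p, C1_on U phi,
      S `&` U = [set x | U x /\ phi x = 0] &
      (forall x, U x -> phi x = 0 -> exists v, 'd phi x v != 0)].

Definition C1_hypersurface (R : realType) (n : nat) (S : set 'rV[R]_n) : Prop :=
  forall p, S p -> exists U phi, local_defining S p U phi.

(* The tangent hyperplane T_p S is {x | d phi_p (x - p) = 0} for a local
   defining function phi; its two open half-spaces are
   {d phi_p (x - p) > 0} and {d phi_p (x - p) < 0}. *)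
Definition strictly_one_side (R : realType) (n : nat) (S : set 'rV[R]_n)
    (p : 'rV[R]_n) (A : set 'rV[R]_n) : Prop :=
  exists U phi, local_defining S p U phi /\
    (A `<=` [set x | 0 < 'd phi p (x - p)] \/
     A `<=` [set x | 'd phi p (x - p) < 0]).

(* Main.v *)
(* For p in S the integrals of f over all spheres centred at p vanish, hence so
   do the Gaussian integrals A(s, p) = int exp(-s |y - p|^2) f(y) dy.  They
   satisfy the heat-type equation Laplacian A + 4 s^2 d_s A = - 2 n s A.  Near
   p0, on the side of S away from supp f, a maximum principle compares A with
   L exp(-s Psi), where Psi is a barrier with Psi(p0) > D = dist(p0, supp f)^2;
   it gives |A(s, p)| <= L exp(-s Psi(p)) on a small ball around a point p1 on
   that side.  Since a product of Gaussians is a Gaussian at the barycentre,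
   the same decay holds for f multiplied by exp(-c |y - y1|^2), for any c > 0.
   Summing exp(-k s (|y - p1|^2 - T)) over k against exponential coefficients
   (Mikusinski's argument) then shows that this product has integral zero over
   every ball |y - p1|^2 < T with T < Psi(p1).  Such a ball can be made to meet
   supp f; as c grows the product concentrates at y1, so f(y1) = 0 for every y1
   in the ball, a contradiction. *)

(* The support of f alone gives |A(s, p)| <= L exp(-s dist(p, supp f)^2), whose rate at p0 is
   exactly D; vanishing on S has to push the rate above D. Since Laplacian + 4 s^2 d_s sends exp(-s
   Psi) to (s^2 |grad Psi|^2 - s Laplacian Psi - 4 s^2 Psi) exp(-s Psi), a barrier works for large s
   as soon as |grad Psi|^2 < 4 Psi, so near p0 every slope below 2 sqrt D is allowed. Strict
   one-sidedness gives supp f a positive height over the tangent plane, so on the far side the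
   squared distance drops from D with slope at most 2 (1 - 2 rho) sqrt D, for some rho > 0. A cone
   of slope 2 (1 - rho) sqrt D fits in between: its vertex is above D, yet on a small sphere around
   p0 it is below the squared distance. The term - 2 n s A is absorbed by a factor exp(kap s) with
   kap small. The evolution runs from s = +oo downwards, so the decay at infinity serves as initial
   data. The Gaussian integrals are only known as values of a bounded linear functional; the
   equation is therefore used through finite differences with error O(t^3), and no derivative of A
   is formed. *)
Require Import Defs.
From HB Require Import structures.
From mathcomp Require Import all_boot all_order all_algebra.
From mathcomp Require Import all_classical all_reals all_analysis.
From mathcomp Require Import measurable_realfun.
From mathcomp Require Import ring lra.
Import Order.TTheory GRing.Theory Num.Theory.
Import numFieldNormedType.Exports.
Local Open Scope classical_set_scope.
Local Open Scope ring_scope.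

(** * Integration over row vectors *)

Section affine_substitution.
Context {R : realType}.
Variables (a b : R).
Let phi (t : measurableTypeR R) : measurableTypeR R := a * t + b.

Lemma measurable_affine : measurable_fun setT phi.
Proof. by apply: measurable_funD => //; apply: measurable_funM. Qed.

Hypothesis a0 : 0 < a.

Let m : {measure set (measurableTypeR R) -> \bar R} :=
  mscale (NngNum (ltW a0))
    (measure_function_pushforward__canonical__measure_function_Measure
       lebesgue_measure measurable_affine).

(** The push-forward of Lebesgue measure under [phi], scaled by [a], has the right value on
    half-open intervals, so it is Lebesgue measure by uniqueness. *)
Lemma ge0_integral_affine (g : R -> \bar R) :
  measurable_fun [set: measurableTypeR R] g -> (forall t, 0 <= g t)%E ->
  (\int[lebesgue_measure]_t g (a * t + b)%R =
   (a^-1)%:E * \int[lebesgue_measure]_t g t)%E.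
Proof.
move=> mg g0.
have muE A : measurable A -> m A = lebesgue_measure A.
  move=> mA; apply/esym/(@lebesgue_measure_unique R m) => //= _ [[x y]] _ <-.
  rewrite /m/= /mscale/= /pushforward/=.
  have -> : phi @^-1` `]x, y] = `](x - b) / a, (y - b) / a]%classic.
    apply/seteqP; split=> t /=; rewrite !in_itv/= /phi ltr_pdivrMr// ler_pdivlMr//;
      by rewrite ltrBlDr lerBrDr mulrC.
  rewrite !lebesgue_measure_itv/= !lte_fin ltr_pM2r ?invr_gt0// ltrD2r.
  case: ifPn => _; last by rewrite mule0.
  by rewrite -EFinM; congr EFin; field; rewrite gt_eqF.
have -> : (\int[lebesgue_measure]_t g t = \int[m]_t g t)%E.
  by apply: eq_measure_integral => A mA _; rewrite muE.
rewrite ge0_integral_mscale//= muleA -EFinM mulVf ?gt_eqF// mul1e.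
by rewrite (ge0_integral_pushforward measurable_affine).
Qed.
End affine_substitution.

Section sigma_finite_product.
Context (R : realType) d d' (T : measurableType d) (T' : measurableType d').
Variables (mu : {sigma_finite_measure set T -> \bar R})
  (mu' : {sigma_finite_measure set T' -> \bar R}).

(** Packaged as a sigma-finite measure so that the product can again be a factor in the induction on
    the dimension. *)
Definition sfprod : set (T * T') -> \bar R := (mu \x mu')%E.

HB.instance Definition _ := Measure.on sfprod.

(* [mu \x mu'] carries this instance only at the level of mixins. *)
Let sfprod_sigma_finite : sigma_finite setT sfprod :=
  isSigmaFinite.sigma_finiteT
    (lebesgue_integral_fubini.measure_function_Measure_isSigmaFinite__to__measure_function_isSigmaFinite mu mu').

HB.instance Definition _ := Measure_isSigmaFinite.Build _ _ _ sfprod sfprod_sigma_finite.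

End sigma_finite_product.

Arguments sfprod {R d d' T T'} mu mu'.

Section iterated_integral.
Context {R : realType}.
Implicit Types (G : (nat -> R) -> \bar R) (c : nat -> R).
Local Open Scope ereal_scope.

(* Tested along measurable families of sequences, which avoids a sigma-algebra
   on [nat -> R]. *)
Definition coord_measurable G := forall d (X : measurableType d) (phi : X -> nat -> R),
  (forall j, measurable_fun setT (phi ^~ j)) ->
  measurable_fun setT (fun x => G (phi x)).

Definition insert (k : nat) (t : R) (x : nat -> R) : nat -> R :=
  fun j => if j == k then t else x j.

Lemma iter_intS k G :
  iter_int k.+1 G = \int[@lebesgue_measure R]_t iter_int k (fun x => G (insert k t x)).
Proof. by []. Qed.

Lemma measurable_insert d (X : measurableType d) k (t : X -> R) (phi : X -> nat -> R) :
  measurable_fun setT t -> (forall j, measurable_fun setT (phi ^~ j)) ->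
  forall j, measurable_fun setT (fun x => insert k (t x) (phi x) j).
Proof. by move=> mt mphi j; rewrite /insert; case: eqP. Qed.

Lemma coord_measurable_insert k t G :
  coord_measurable G -> coord_measurable (fun x => G (insert k t x)).
Proof. by move=> mG d X phi mphi; apply: mG; exact: measurable_insert. Qed.

(** The indicator of a cube in the first [k] coordinates. It is the dominating function for signed
    integrands, and as a product its iterated integral is explicit. *)
Definition box (c : nat -> R) (a : R) (k : nat) (x : nat -> R) : R :=
  (\prod_(j < k) (if `|x j - c j| <= a then 1 else 0))%R.

Lemma box_ge0 c a k x : (0 <= box c a k x)%R.
Proof. by apply: prodr_ge0 => j _; case: ifP. Qed.

Lemma box_insert c a k t x :
  box c a k.+1 (insert k t x) = (box c a k x * (if `|t - c k| <= a then 1 else 0))%R.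
Proof.
rewrite /box big_ord_recr/= /insert eqxx; congr (_ * _)%R.
by apply: eq_bigr => j _; rewrite ltn_eqF.
Qed.

Lemma coord_measurable_box c a k M : coord_measurable (fun x => (M * box c a k x)%:E).
Proof.
move=> d X phi mphi; apply/measurable_EFinP/measurable_funM => //.
elim: k => [|k IH].
  by rewrite (_ : (fun _ => _) = cst 1%R)//; apply/funext => x; rewrite /box big_ord0.
rewrite (_ : (fun _ => _) =
  (fun x => box c a k (phi x)) \* (fun x => if `|phi x k - c k| <= a then 1 else 0))%R; last first.
  by apply/funext => x; rewrite /box/= big_ord_recr.
apply: measurable_funM => //; apply: measurable_fun_ifT => //.
apply: measurable_fun_ler => //; apply: measurableT_comp => //.
exact: measurable_funB.
Qed.

Lemma iter_int_box c a k M : (0 <= a)%R -> (0 <= M)%R ->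
  iter_int k (fun x => (M * box c a k x)%:E) = (M * (2 * a) ^+ k)%:E.
Proof.
move=> a0; elim: k M => [|k IH] M M0; first by rewrite /= /box big_ord0 expr0.
rewrite iter_intS.
transitivity (\int[@lebesgue_measure R]_t
    ((M * (2 * a) ^+ k)%:E * (\1_(`[(c k - a)%R, (c k + a)%R]%classic) t)%:E)).
  apply: eq_integral => t _; rewrite -EFinM.
  under [X in iter_int k X]funext do rewrite box_insert mulrC -mulrA mulrC.
  rewrite IH; last by rewrite mulr_ge0//; case: ifP.
  congr EFin; rewrite -mulrA mulrC; congr (_ * _)%R.
  rewrite indicE mem_setE in_itv/= ler_distl; case: ifP => //.
rewrite ge0_integralZl//; last 2 first.
  by apply/measurable_EFinP; exact: measurable_indic.
  by rewrite lee_fin mulr_ge0// exprn_ge0// mulr_ge0.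
rewrite integral_indic//= setIT lebesgue_measure_itv/= lte_fin.
have [ha|ha] := ltP (c k - a)%R (c k + a)%R.
  rewrite -EFinB -EFinM exprSr mulrA; congr (_ * _)%:E; lra.
have -> : a = 0%R by lra.
by rewrite mule0 exprS !(mulr0,mul0r).
Qed.

(** Nested integrals have no usable linearity or monotonicity for signed functions; a single measure
    space representing all of them restores both. The induction adds one Lebesgue factor, by Tonelli
    for nonnegative integrands and by Fubini for those dominated by a [box]. *)
Lemma iter_int_model k : exists d (T : measurableType d)
    (mu : {sigma_finite_measure set T -> \bar R}) (ev : T -> nat -> R),
  [/\ forall j, measurable_fun setT (ev ^~ j),
      forall G, coord_measurable G -> (forall x, 0 <= G x) ->
        iter_int k G = \int[mu]_u G (ev u) &
      forall G c a M, (0 <= a)%R -> (0 <= M)%R -> coord_measurable G ->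
        (forall x, `|G x| <= (M * box c a k x)%:E) ->
        iter_int k G = \int[mu]_u G (ev u)].
Proof.
elim: k => [|k [d [T [mu [ev [mev IH0 IH]]]]]].
  exists _, unit, (\d_tt), (fun _ _ => 0%R); split => //= G; last move=> c a M.
  - by move=> _ _; rewrite integral_dirac//= diracE mem_set// mul1e.
  - by move=> _ _; rewrite integral_dirac//= diracE mem_set// mul1e.
pose mu' : {sigma_finite_measure set (measurableTypeR R * T)%type -> \bar R} :=
  sfprod lebesgue_measure mu.
pose ev' (tu : measurableTypeR R * T) := insert k tu.1 (ev tu.2).
have mev' j : measurable_fun setT (ev' ^~ j).
  by apply: measurable_insert => // i; exact: (measurableT_comp (mev i) measurable_snd).
(* The nonnegative case comes first: applied to [box], it yields the integrability that Fubini
   requires in the signed case. *)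
have H0 G : coord_measurable G -> (forall x, 0 <= G x) ->
    iter_int k.+1 G = \int[mu']_u G (ev' u).
  move=> mG G0; rewrite iter_intS [RHS]fubini_tonelli1//; last exact: mG.
  apply: eq_integral => t _.
  by rewrite (IH0 (fun x => G (insert k t x)))//; exact: coord_measurable_insert.
exists _, (measurableTypeR R * T)%type, mu', ev'; split => //.
move=> G c a M a0 M0 mG GM.
have iG : mu'.-integrable setT (fun u => G (ev' u)).
  apply/integrableP; split; first exact: mG.
  apply: (@le_lt_trans _ _ (\int[mu']_u (M * box c a k.+1 (ev' u))%:E)).
    apply: ge0_le_integral => //.
    - by apply: measurableT_comp => //; exact: mG.
    - exact: coord_measurable_box.
  rewrite -(H0 (fun x => (M * box c a k.+1 x)%:E)) ?iter_int_box ?ltry//.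
    exact: coord_measurable_box.
  by move=> x; rewrite lee_fin mulr_ge0// box_ge0.
rewrite iter_intS; apply: etrans (integral12_prod_meas1 iG).
apply: eq_integral => t _.
rewrite (IH (fun x => G (insert k t x)) c a M)//; first exact: coord_measurable_insert.
move=> x; apply: (le_trans (GM _)); rewrite lee_fin ler_wpM2l// box_insert.
by rewrite ler_piMr ?box_ge0//; case: ifP.
Qed.
End iterated_integral.

Section iterated_integral_theory.
Context {R : realType}.
Implicit Types (G : (nat -> R) -> \bar R).
Local Open Scope ereal_scope.

Lemma iter_int_ge0 k G : (forall x, 0 <= G x) -> 0 <= iter_int k G.
Proof.
elim: k G => [|k IH] G G0; first exact: G0.
by apply: integral_ge0 => t _; apply: IH.
Qed.

Lemma measurable_iter_int k d (X : measurableType d) (H : X -> (nat -> R) -> \bar R) :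
  (forall x y, 0 <= H x y) ->
  (forall d' (Y : measurableType d') (psi : Y -> X) (phi : Y -> nat -> R),
    measurable_fun setT psi -> (forall j, measurable_fun setT (phi ^~ j)) ->
    measurable_fun setT (fun y => H (psi y) (phi y))) ->
  measurable_fun setT (fun x => iter_int k (H x)).
Proof.
move=> H0 mH; have [d' [T [mu [ev [mev int0 _]]]]] := @iter_int_model R k.
rewrite (_ : (fun _ => _) = fubini_F mu (fun xu => H xu.1 (ev xu.2))).
  apply: measurable_fun_fubini_tonelli_F => //; apply: mH => // j.
  exact: (measurableT_comp (mev j) measurable_snd).
apply/funext => x; rewrite int0// => d2 Y phi mphi.
by apply: (mH _ _ (fun=> x)).
Qed.

(** That [G] reads only the first [k] coordinates matters already for [k = 0], where the two sides
    are the values of [G] at [b] and at the zero sequence. *)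
Lemma iter_int_affine k G (a : R) (b : nat -> R) : (0 < a)%R ->
  coord_measurable G -> (forall x, 0 <= G x) ->
  (forall x y, (forall j, (j < k)%N -> x j = y j) -> G x = G y) ->
  iter_int k (fun x => G (fun j => a * x j + b j)%R) =
  ((a^-1) ^+ k)%:E * iter_int k G.
Proof.
move=> a0; elim: k G => [|k IH] G mG G0 Gk; first by rewrite mul1e; apply: Gk.
pose H t := iter_int k (fun x => G (insert k t x)).
have mH : measurable_fun setT H.
  apply: (@measurable_iter_int _ _ _ (fun t x => G (insert k t x))) => //.
  by move=> d Y psi phi mpsi mphi; apply: mG; apply: measurable_insert.
rewrite iter_intS.
transitivity (\int[@lebesgue_measure R]_t (((a^-1) ^+ k)%:E * H (a * t + b k)%R)).
  apply: eq_integral => t _; rewrite -IH//.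
  - congr iter_int; apply/funext => x; congr G; apply/funext => j.
    by rewrite /insert; case: eqP => // ->.
  - exact: coord_measurable_insert.
  - move=> x y xy; apply: Gk => j; rewrite ltnS leq_eqVlt /insert.
    by case: eqP => //= _; exact: xy.
rewrite ge0_integralZl//; last 3 first.
- apply: (measurableT_comp mH).
  by apply: measurable_funD => //; apply: measurable_funM.
- by move=> t _; apply: iter_int_ge0.
- by rewrite lee_fin exprn_ge0// invr_ge0 ltW.
rewrite ge0_integral_affine//; last by move=> t; apply: iter_int_ge0.
by rewrite muleA -EFinM exprSr.
Qed.
End iterated_integral_theory.

Section row_vectors.
Context {R : realType} {n : nat}.
Local Open Scope ereal_scope.

Lemma le_coord_norm (v : 'rV[R]_n) i : (`|v ord0 i| <= `|v|)%R.
Proof.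
rewrite [leRHS]/Num.norm /= mx_normrE; apply/bigmax_geP; right => /=.
by exists (ord0, i).
Qed.

Lemma norm_rV_lt (v : 'rV[R]_n) e : (0 < e)%R ->
  (forall i, `|v ord0 i| < e)%R -> (`|v| < e)%R.
Proof.
move=> e0 ve; rewrite /Num.norm /= mx_normrE; apply/bigmax_ltP; split => //.
by move=> [i j] _ /=; rewrite ord1.
Qed.

(** Every open set is a countable union of cubes with rational centre and side parameter
    [m.+1%:R^-1], and the preimage of a cube is a finite intersection of coordinate conditions. *)
Lemma measurable_continuous_rV d (X : measurableType d) (phi : X -> 'rV[R]_n)
    (F : 'rV[R]_n -> R) :
  (forall i, measurable_fun setT (fun x => phi x ord0 i)) ->
  continuous F -> measurable_fun setT (F \o phi).
Proof.
move=> mphi cF.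
have mO (O : set 'rV[R]_n) : open O -> measurable (phi @^-1` O).
  move=> oO.
  pose B (qm : 'rV[rat]_n * nat) : set 'rV[R]_n :=
    [set v | forall i, `|v ord0 i - ratr (qm.1 ord0 i)| < qm.2.+1%:R^-1]%R.
  have -> : O = \bigcup_qm (if `[< B qm `<=` O >] then B qm else set0).
    apply/seteqP; split => [v Ov|v [qm _]]; last first.
      by case: asboolP => // BO /BO.
    have /nbhs_ballP[e /= e0 veO] := oO v Ov.
    have [m me] : exists m, (m.+1%:R^-1 < e / 2 :> R)%R.
      have e20 : (0 < e / 2)%R by rewrite divr_gt0.
      by have [m _ /(_ m (leqnn _))] := near_infty_natSinv_lt (PosNum e20); exists m.
    have qP i : exists q : rat, (`|v ord0 i - ratr q| < m.+1%:R^-1)%R.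
      have : (v ord0 i - m.+1%:R^-1 < v ord0 i + m.+1%:R^-1 :> R)%R.
        by rewrite ltrD2l gtrN// invr_gt0.
      by move=> /rat_in_itvoo[q]; rewrite in_itv/= -ltr_distl distrC; exists q.
    pose q : 'rV[rat]_n := \row_i xget 0%R [set q : rat | (`|v ord0 i - ratr q| < m.+1%:R^-1)%R].
    have qE i : (`|v ord0 i - ratr (q ord0 i)| < m.+1%:R^-1)%R.
      by rewrite mxE; case: xgetP => [x -> //|]; have [x xP] := qP i => /(_ x).
    exists (q, m) => //; case: asboolP => //; case=> w Bw; apply: veO.
    rewrite -ball_normE /ball_/=; apply: norm_rV_lt => // i; rewrite !mxE.
    have := Bw i; rewrite distrC /= => wi.
    rewrite (splitr e) (_ : v ord0 i - w ord0 i =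
      (v ord0 i - ratr (q ord0 i)) + (ratr (q ord0 i) - w ord0 i))%R; last by ring.
    by rewrite (le_lt_trans (ler_normD _ _))// ltrD// (lt_trans _ me).
  rewrite preimage_bigcup.
  apply: countable_bigcupT_measurable => // -[q m]; case: asboolP => [_|_]; last by rewrite preimage_set0.
  have -> : phi @^-1` B (q, m) = \bigcap_(i in [set: 'I_n])
      (fun x => phi x ord0 i) @^-1` [set r | `|r - ratr (q ord0 i)| < m.+1%:R^-1]%R.
    by apply/seteqP; split => x /= Bx i => [_|]; apply: Bx.
  apply: fin_bigcap_measurable => // i _; rewrite -[X in measurable X]setTI.
  apply: mphi => //.
  rewrite (_ : [set r | _] = `](ratr (q ord0 i) - m.+1%:R^-1)%R,
                               (ratr (q ord0 i) + m.+1%:R^-1)%R[%classic)//.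
  by apply/seteqP; split => r; rewrite /= in_itv/= ltr_distl.
move=> _; apply: (measurability _ (RGenOInfty.measurableE R)) => //.
move=> /= _ [_ [a ->] <-]; rewrite setTI comp_preimage; apply: mO.
by apply: open_comp => // x _; exact: cF.
Qed.
End row_vectors.

Section row_integral.
Context {R : realType} {n : nat}.
Implicit Types g : 'rV[R]_n -> \bar R.
Local Open Scope ereal_scope.

Definition row_measurable g := forall d (X : measurableType d) (phi : X -> 'rV[R]_n),
  (forall i, measurable_fun setT (fun x => phi x ord0 i)) ->
  measurable_fun setT (g \o phi).

Lemma coord_measurable_row g : row_measurable g ->
  coord_measurable (fun x => g (\row_i x i)).
Proof.
move=> mg d X phi mphi; apply: (mg _ _ (fun x => \row_i phi x i)) => i.
by under eq_fun do rewrite mxE; exact: mphi.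
Qed.

Lemma row_measurable_EFin (F : 'rV[R]_n -> R) : continuous F ->
  row_measurable (EFin \o F).
Proof.
move=> cF d X phi mphi.
by apply/measurable_EFinP; exact: measurable_continuous_rV.
Qed.

(* The library has no Lebesgue measure on ['rV[R]_n]: [mu] and [pt] present
   [Rn_integral] as an integral over some sigma-finite space. *)
Definition Rn_model d (T : measurableType d)
    (mu : {sigma_finite_measure set T -> \bar R}) (pt : T -> 'rV[R]_n) : Prop :=
  [/\ forall i, measurable_fun setT (fun u => pt u ord0 i),
      forall g, row_measurable g -> (forall x, 0 <= g x) ->
        Rn_integral g = \int[mu]_u g (pt u) &
      forall g M a, (0 <= a)%R -> (0 <= M)%R -> row_measurable g ->
        (forall x, `|g x| <= M%:E) -> (forall x, (a < `|x|)%R -> g x = 0) ->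
        mu.-integrable setT (fun u => g (pt u)) /\
        Rn_integral g = \int[mu]_u g (pt u)].

Arguments Rn_model {d T} mu pt.

Lemma Rn_modelP : exists d (T : measurableType d)
  (mu : {sigma_finite_measure set T -> \bar R}) (pt : T -> 'rV[R]_n), Rn_model mu pt.
Proof.
have [d [T [mu [ev [mev int0 intb]]]]] := @iter_int_model R n.
exists d, T, mu, (fun u => \row_i ev u i); split.
- by move=> i; under eq_fun do rewrite mxE; exact: mev.
- move=> g mg g0; apply: (int0 (fun x => g (\row_i x i))) => //.
  exact: coord_measurable_row.
- move=> g M a a0 M0 mg gM ga.
  have cg : coord_measurable (fun x => g (\row_i x i)) by exact: coord_measurable_row.
  have gbox (x : nat -> R) : `|g (\row_i x i)| <= (M * box (fun=> 0%R) a n x)%:E.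
    have [xa|] := boolP [forall j : 'I_n, `|x j| <= a]%R.
      rewrite /box big1 ?mulr1// => j _; rewrite subr0.
      by move/forallP: xa => ->.
    move=> /forallPn[j]; rewrite -ltNge => axj.
    rewrite ga ?abse0 ?lee_fin ?mulr_ge0 ?box_ge0//.
    by rewrite (lt_le_trans axj)// (le_trans _ (le_coord_norm _ j))// mxE.
  split; last exact: (intb _ (fun=> 0%R) a M).
  apply/integrableP; split; first by apply: cg.
  apply: (@le_lt_trans _ _ (\int[mu]_u (M * box (fun=> 0%R) a n (ev u))%:E)).
    apply: ge0_le_integral => //.
    - by apply: measurableT_comp => //; exact: cg.
    - exact: coord_measurable_box.
  rewrite -(int0 (fun x => (M * box (fun=> 0%R) a n x)%:E)) ?iter_int_box ?ltry//.
    exact: coord_measurable_box.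
  by move=> x; rewrite lee_fin mulr_ge0// box_ge0.
Qed.

Lemma Rn_integral_affine g (a : R) (b : 'rV[R]_n) : (0 < a)%R ->
  row_measurable g -> (forall x, 0 <= g x) ->
  Rn_integral (fun x => g (a *: x + b)%R) = ((a^-1) ^+ n)%:E * Rn_integral g.
Proof.
move=> a0 mg g0.
pose b' (j : nat) := (if insub j is Some i then b ord0 i else 0)%R.
rewrite /Rn_integral -(@iter_int_affine _ n (fun x => g (\row_i x i)) a b')//.
- congr iter_int; apply/funext => x; congr g; apply/rowP => i.
  by rewrite !mxE /b' valK.
- exact: coord_measurable_row.
- by move=> x y xy; congr g; apply/rowP => i; rewrite !mxE xy.
Qed.

End row_integral.
Arguments Rn_model {R n d T} mu pt.

(** * Polar coordinates *)

Section euclidean_norm.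
Context {R : realType} {n : nat}.
Implicit Types x y : 'rV[R]_n.

Lemma sum_sqr_ge0 x : 0 <= \sum_(i < n) x ord0 i ^+ 2.
Proof. by apply: sumr_ge0 => i _; rewrite sqr_ge0. Qed.

Lemma enorm_ge0 x : 0 <= enorm x.
Proof. by rewrite sqrtr_ge0. Qed.

Lemma sqr_enorm x : enorm x ^+ 2 = \sum_(i < n) x ord0 i ^+ 2.
Proof. by rewrite sqr_sqrtr// sum_sqr_ge0. Qed.

Lemma enormZ (a : R) x : enorm (a *: x) = `|a| * enorm x.
Proof.
rewrite /enorm -sqrtr_sqr -sqrtrM ?sqr_ge0//; congr Num.sqrt.
by rewrite mulr_sumr; apply: eq_bigr => i _; rewrite mxE exprMn.
Qed.

Lemma continuous_sum_sqr : continuous (fun x => \sum_(i < n) x ord0 i ^+ 2).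
Proof.
apply: continuous_big => [|i _ x]; first exact: add_continuous.
apply: (@continuous_comp _ _ _ (fun x : 'rV[R]_n => x ord0 i) (fun r => r ^+ 2)).
  exact: coord_continuous.
exact: exprn_continuous.
Qed.

Lemma continuous_enorm : continuous (@enorm R n).
Proof.
rewrite (_ : @enorm R n = Num.sqrt \o (fun x : 'rV_n => \sum_(i < n) x ord0 i ^+ 2))//.
move=> x; apply: continuous_comp.
  exact: continuous_sum_sqr.
exact: sqrt_continuous.
Qed.

End euclidean_norm.

Lemma measurable_invr (R : realType) : measurable_fun [set: R] (@GRing.inv R).
Proof.
rewrite (_ : GRing.inv = fun r : R => if 0 <= r then `|r| `^ (-1) else - (`|r| `^ (-1))).
  apply: measurable_fun_ifT.
  - exact: measurable_fun_ler.
  - exact: (measurableT_comp (measurable_powR (-1)) (@normr_measurable R setT)).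
  - apply: measurableT_comp => //.
    exact: (measurableT_comp (measurable_powR (-1)) (@normr_measurable R setT)).
apply/funext => r; rewrite powR_inv1//; case: ifPn => [r0|]; first by rewrite ger0_norm.
by rewrite -ltNge => r0; rewrite ltr0_norm// invrN opprK.
Qed.

Section radial_mass.
Context {R : realType} (m : nat).
Local Notation n := m.+1.
Local Open Scope ereal_scope.
Local Notation leb := (@lebesgue_measure R).

Definition radial_density (v : R) : R := (if 1 < v then (v^-1) ^+ n.+1 else 0)%R.

Lemma radial_density_ge0 v : (0 <= radial_density v)%R.
Proof.
rewrite /radial_density; case: ifP => // v1.
by rewrite exprn_ge0// invr_ge0 (le_trans ler01)// ltW.
Qed.

Lemma measurable_radial_density : measurable_fun [set: measurableTypeR R] (EFin \o radial_density).
Proof.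
apply/measurable_EFinP; apply: measurable_fun_ifT => //; first exact: measurable_fun_ltr.
by apply: measurable_funX; exact: measurable_invr.
Qed.

(** The integral of v^(-n-1) over v > 1, that is 1/n, which the factor n of the cone measure would
    cancel. Only its positivity and finiteness are established, enough to divide by it. *)
Definition radial_mass : \bar R := \int[leb]_v (radial_density v)%:E.

Lemma radial_mass_gt0 : 0 < radial_mass.
Proof.
apply: (@lt_le_trans _ _ (\int[leb]_v ((3^-1 ^+ n.+1)%:E * (\1_(`[2%R, 3%R]%classic) v)%:E))).
  rewrite ge0_integralZl//; last by apply/measurable_EFinP; exact: measurable_indic.
  rewrite integral_indic//= setIT lebesgue_measure_itv/= lte_fin ltr_nat/=.
  by rewrite -EFinB -EFinM lte_fin mulr_gt0 ?exprn_gt0 ?invr_gt0//; lra.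
apply: ge0_le_integral => //.
- by apply: emeasurable_funM => //; apply/measurable_EFinP; exact: measurable_indic.
- exact: measurable_radial_density.
move=> v _; rewrite -EFinM lee_fin indicE mem_setE in_itv/=.
case: (boolP (2 <= v <= 3)%R) => [/andP[v2 v3]|_]; last by rewrite mulr0 radial_density_ge0.
rewrite mulr1 /radial_density (lt_le_trans _ v2) ?ltr1n// lerXn2r ?nnegrE ?invr_ge0//.
  by rewrite (le_trans _ v2).
have v0 : (0 < v)%R by rewrite (lt_le_trans _ v2).
by rewrite lef_pV2 ?posrE.
Qed.

(** For v > 1 the density is at most v^(-2) <= 2 / (1 + v^2), and the integral of the latter over
    the half-line is known. *)
Lemma radial_mass_lty : radial_mass < +oo.
Proof.
have mD : measurable_fun [set: measurableTypeR R] (fun v => (oneDsqr v)^-1)%R.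
  exact: (continuous_measurable_fun (@continuous_oneDsqrV R)).
apply: (@le_lt_trans _ _ (\int[leb]_(v in `[0%R, +oo[) (2%:E * ((oneDsqr v)^-1)%:E))); last first.
  rewrite ge0_integralZl//.
    by rewrite integral0y_oneDsqr -EFinM ltry.
  by apply/measurable_EFinP; exact: measurable_funTS.
rewrite [leRHS]integral_mkcond; apply: ge0_le_integral => //.
- by move=> v _; rewrite lee_fin radial_density_ge0.
- exact: measurable_radial_density.
- apply/(measurable_restrictT _ _).1 => //; apply/measurable_funTS.
  by apply: emeasurable_funM => //; exact/measurable_EFinP.
move=> v _; rewrite patchE /radial_density; case: ltP => v1; last first.
  by case: ifP => // _; rewrite -EFinM lee_fin.
rewrite mem_set/=; last by rewrite in_itv/= andbT (le_trans ler01)// ltW.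
rewrite -EFinM lee_fin /oneDsqr.
have v0 : (0 < v)%R by rewrite (lt_trans ltr01).
apply: (@le_trans _ _ (v^-1 ^+ 2)%R).
  rewrite -[leRHS]mulr1 -[in leLHS](addn2 m) exprD mulrC.
  by rewrite ler_wpM2l ?sqr_ge0// exprn_ile1// ?invr_ge0 ?invf_le1// ltW.
rewrite exprVn ler_pdivlMr ?addr_gt0 ?exprn_gt0// mulrC ler_pdivrMr ?exprn_gt0//.
have : (1 <= v ^+ 2)%R by rewrite exprn_ege1// ltW.
lra.
Qed.

End radial_mass.

Section polar_coordinates.
Context {R : realType} {m : nat}.
Local Notation n := m.+1.
Context d (T : measurableType d) (mu : {sigma_finite_measure set T -> \bar R})
  (pt : T -> 'rV[R]_n).
Hypothesis model : Rn_model mu pt.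
Variables (h : R -> R) (f : 'rV[R]_n -> R).
Hypotheses (h0 : forall r, 0 <= h r) (mh : measurable_fun setT h).
Hypotheses (f0 : forall x, 0 <= f x) (cf : continuous f).
Local Open Scope ereal_scope.
Local Notation leb := (@lebesgue_measure R).

Let w u := enorm (pt u).

Let mpt i : measurable_fun setT (fun u => pt u ord0 i).
Proof. by case: model. Qed.

Let mw : measurable_fun setT w.
Proof. exact: (@measurable_continuous_rV R n _ _ pt _ mpt continuous_enorm). Qed.

(** [K1], [K2], [K3] are the integrand at the successive stages. Passing to [K2] produces the
    Jacobian [w]; passing to [K3] produces s^(-n), and one more s^(-1) because w^n h f keeps a
    factor [w] that is rescaled. *)
Let K1 (ru : measurableTypeR R * T) : R :=
  (if (0 < ru.1) && ((0 < w ru.2) && (w ru.2 < 1))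
  then ru.1 ^+ m * h ru.1 * f ((ru.1 / w ru.2) *: pt ru.2) else 0)%R.

Let K2 (su : measurableTypeR R * T) : R :=
  (if (0 < su.1) && ((0 < w su.2) && (w su.2 < 1))
  then w su.2 * (w su.2 * su.1) ^+ m * h (w su.2 * su.1) * f (su.1 *: pt su.2) else 0)%R.

Let K3 (su : measurableTypeR R * T) : R :=
  (if (0 < su.1) && ((0 < w su.2) && (w su.2 < su.1))
  then su.1^-1 ^+ n.+1 * (w su.2 ^+ n * h (w su.2) * f (pt su.2)) else 0)%R.

Let m_scale d' (X : measurableType d') (a : X -> R) (phi : X -> 'rV[R]_n) :
  measurable_fun setT a -> (forall i, measurable_fun setT (fun x => phi x ord0 i)) ->
  measurable_fun setT (fun x => f (a x *: phi x))%R.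
Proof.
move=> ma mphi; apply: (@measurable_continuous_rV _ _ _ _ (fun x => (a x *: phi x)%R)) => //.
by move=> i; under eq_fun do rewrite mxE; exact: measurable_funM.
Qed.

Let mpt2 i : measurable_fun setT (fun ru : measurableTypeR R * T => pt ru.2 ord0 i).
Proof. exact: (measurableT_comp (mpt i) measurable_snd). Qed.

Let mw2 : measurable_fun setT (fun ru : measurableTypeR R * T => w ru.2).
Proof. exact: (measurableT_comp mw measurable_snd). Qed.

Let mK1 : measurable_fun setT K1.
Proof.
apply: measurable_fun_ifT => //.
  apply: measurable_and; first exact: measurable_fun_ltr.
  by apply: measurable_and; exact: measurable_fun_ltr.
apply: measurable_funM; last first.
  apply: m_scale => //; apply: measurable_funM => //.
  exact: (measurableT_comp (measurable_invr R) mw2).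
apply: measurable_funM; first exact: measurable_funX.
exact: (measurableT_comp mh measurable_fst).
Qed.

Let mK2 : measurable_fun setT K2.
Proof.
apply: measurable_fun_ifT => //.
  apply: measurable_and; first exact: measurable_fun_ltr.
  by apply: measurable_and; exact: measurable_fun_ltr.
apply: measurable_funM; last exact: m_scale.
apply: measurable_funM; last by apply: (measurableT_comp mh); exact: measurable_funM.
apply: measurable_funM => //.
by apply: measurable_funX; apply: measurable_funM.
Qed.

Let mK3 : measurable_fun setT K3.
Proof.
apply: measurable_fun_ifT => //.
  apply: measurable_and; first exact: measurable_fun_ltr.
  by apply: measurable_and; exact: measurable_fun_ltr.
apply: measurable_funM.
  apply: measurable_funX; exact: (measurableT_comp (measurable_invr R) measurable_fst).
apply: measurable_funM.
  apply: measurable_funM; first exact: measurable_funX.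
  exact: (measurableT_comp mh).
by under eq_fun do rewrite -[pt _]scale1r; exact: m_scale.
Qed.

Let K1_ge0 ru : (0 <= K1 ru)%R.
Proof.
rewrite /K1; case: ifP => // /andP[r0 _].
by rewrite !mulr_ge0// exprn_ge0// ltW.
Qed.

Let K2_ge0 ru : (0 <= K2 ru)%R.
Proof.
rewrite /K2; case: ifP => // /andP[r0 /andP[w0 _]].
by rewrite !mulr_ge0// ?exprn_ge0 ?mulr_ge0// ltW.
Qed.

Let K3_ge0 ru : (0 <= K3 ru)%R.
Proof.
rewrite /K3; case: ifP => // /andP[r0 /andP[w0 _]].
by rewrite mulr_ge0 ?exprn_ge0 ?invr_ge0 ?(ltW r0)// !mulr_ge0// exprn_ge0// ltW.
Qed.

Let swap (K : measurableTypeR R * T -> R) :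
  measurable_fun setT K -> (forall ru, 0 <= K ru)%R ->
  \int[leb]_r \int[mu]_u (K (r, u))%:E = \int[mu]_u \int[leb]_r (K (r, u))%:E.
Proof.
move=> mK K0; apply: (fubini_tonelli (fun ru => (K ru)%:E)) => //.
exact/measurable_EFinP.
Qed.

Let m_pair1 (K : measurableTypeR R * T -> R) u : measurable_fun setT K ->
  measurable_fun setT (fun r : measurableTypeR R => (K (r, u))%:E).
Proof. by move=> mK; apply/measurable_EFinP; apply: (measurableT_comp mK). Qed.

Let m_enorm d' (X : measurableType d') (phi : X -> 'rV[R]_n) :
  (forall i, measurable_fun setT (fun x => phi x ord0 i)) ->
  measurable_fun setT (fun x => enorm (phi x)).
Proof. by move=> mphi; exact: (@measurable_continuous_rV R n _ _ phi _ mphi continuous_enorm). Qed.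

Let m_sphere (r : R) : row_measurable (fun x : 'rV[R]_n =>
  if ((0 < enorm x) && (enorm x < 1))%R then (f ((r / enorm x) *: x)%R)%:E else 0).
Proof.
move=> d' X phi mphi.
have mn : measurable_fun setT (fun x => enorm (phi x)).
  exact: m_enorm.
apply: measurable_fun_ifT => //; first by apply: measurable_and; exact: measurable_fun_ltr.
apply/measurable_EFinP; apply: m_scale => //; apply: measurable_funM => //.
exact: (measurableT_comp (measurable_invr R) mn).
Qed.

(* Fubini, the substitution [r = |x| s], then [x := x / s]; what remains of the
   integral over [s] is [radial_mass]. *)
Lemma polar_coordinates :
  \int[leb]_r ((if (0 < r)%R then r ^+ m * h r else 0)%R%:E *
    Rn_integral (fun x => if ((0 < enorm x) && (enorm x < 1))%R
                          then (f ((r / enorm x) *: x)%R)%:E else 0)) =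
  radial_mass m * Rn_integral (fun x => (if 0 < enorm x then h (enorm x) * f x else 0)%R%:E).
Proof.
have [_ int0 _] := model.
transitivity (\int[leb]_r \int[mu]_u (K1 (r, u))%:E).
  apply: eq_integral => r _; rewrite int0; last 2 first.
  - exact: m_sphere.
  - by move=> x; case: ifP => // _; rewrite lee_fin.
  rewrite -ge0_integralZl//; last 3 first.
  - exact: m_sphere.
  - by move=> u _; case: ifP => // _; rewrite lee_fin.
  - by rewrite lee_fin; case: ifP => // r0; rewrite mulr_ge0// exprn_ge0// ltW.
  apply: eq_integral => u _; rewrite /K1/= -/(w u).
  by case: ifP => r0 /=; case: ifP => //= _; rewrite ?mul0e ?mule0.
rewrite swap//.
transitivity (\int[mu]_u \int[leb]_s (K2 (s, u))%:E).
  apply: eq_integral => u _.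
  have [w0|w0] := boolP ((0 < w u) && (w u < 1))%R; last first.
    by rewrite !integral0_eq// => r _; rewrite /K1 /K2/= (negbTE w0) andbF.
  have w_gt0 : (0 < w u)%R by case/andP: w0.
  have -> : \int[leb]_s (K2 (s, u))%:E = \int[leb]_s ((w u)%:E * (K1 (w u * s + 0, u)%R)%:E).
    apply: eq_integral => s _; rewrite /K1 /K2/= addr0 w0 !andbT pmulr_rgt0//.
    case: ifP => s0; last by rewrite mule0.
    by rewrite -EFinM !mulrA; congr ((_ * _ * _) * f (_ *: _))%:E; field; rewrite gt_eqF.
  rewrite ge0_integralZl//; last 3 first.
  - exact: (measurableT_comp (m_pair1 K1 u mK1) (measurable_affine (w u) 0)).
  - by move=> s _; rewrite lee_fin.
  - by rewrite lee_fin ltW.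
  rewrite (ge0_integral_affine _ _ w_gt0 (fun s => (K1 (s, u))%:E)); last 2 first.
  - exact: (m_pair1 K1 u mK1).
  - by move=> t; rewrite lee_fin.
  by rewrite muleA -EFinM mulfV ?gt_eqF// mul1e.
rewrite -(swap K2 mK2 K2_ge0).
transitivity (\int[leb]_s \int[mu]_u (K3 (s, u))%:E).
  apply: eq_integral => s _.
  have [s0|s0] := ltP 0%R s; last first.
    by rewrite !integral0_eq// => r _; rewrite /K2 /K3/= ltNge s0.
  pose k (y : 'rV[R]_n) : \bar R := (if (0 < enorm y) && (enorm y < s)
    then s^-1 * (enorm y ^+ n * h (enorm y) * f y) else 0)%R%:E.
  have mk : row_measurable k.
    move=> d' X phi mphi.
    have mn : measurable_fun setT (fun x => enorm (phi x)) by exact: m_enorm.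
    apply/measurable_EFinP; apply: measurable_fun_ifT => //.
      by apply: measurable_and; exact: measurable_fun_ltr.
    apply: measurable_funM => //; apply: measurable_funM; last exact: measurable_continuous_rV.
    apply: measurable_funM; first exact: measurable_funX.
    exact: (measurableT_comp mh).
  have k0 x : 0 <= k x.
    rewrite /k lee_fin; case: ifP => // _.
    by rewrite mulr_ge0 ?invr_ge0 ?(ltW s0)// !mulr_ge0// exprn_ge0// enorm_ge0.
  transitivity (\int[mu]_u k (s *: pt u + 0)%R).
    apply: eq_integral => u _; rewrite /k /K2/= addr0 enormZ gtr0_norm// s0 -/(w u).
    rewrite pmulr_rgt0// gtr_pMr//=; case: ifP => // _; congr EFin.
    by rewrite [(s * w u)%R]mulrC [in RHS]exprS; field; rewrite gt_eqF.
  rewrite -(int0 (fun x => k (s *: x + 0)%R))//; last first.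
    move=> d' X phi mphi; apply: (mk _ _ (fun x => s *: phi x + 0)%R) => i.
    under eq_fun do rewrite !mxE addr0.
    by apply: measurable_funM.
  rewrite (Rn_integral_affine k s 0 s0 mk k0) int0// -ge0_integralZl//; last 2 first.
  - exact: mk.
  - by rewrite lee_fin exprn_ge0// invr_ge0 ltW.
  apply: eq_integral => u _; rewrite /k /K3/= s0 -/(w u).
  case: ifP => _; last by rewrite mule0.
  by rewrite -EFinM; congr EFin; rewrite [in RHS]exprS; ring.
have mg : row_measurable (fun x : 'rV[R]_n => (if 0 < enorm x then h (enorm x) * f x else 0)%R%:E).
  move=> d' X phi mphi.
  have mn : measurable_fun setT (fun x => enorm (phi x)) by exact: m_enorm.
  apply/measurable_EFinP; apply: measurable_fun_ifT => //; first exact: measurable_fun_ltr.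
  apply: measurable_funM; last exact: measurable_continuous_rV.
  exact: (measurableT_comp mh).
have g0 (x : 'rV[R]_n) : 0 <= (if 0 < enorm x then h (enorm x) * f x else 0)%R%:E.
  by rewrite lee_fin; case: ifP => // _; rewrite mulr_ge0.
rewrite swap// int0// -ge0_integralZl//; last 2 first.
- exact: mg.
- exact: ltW (radial_mass_gt0 _).
apply: eq_integral => u _; rewrite -/(w u).
have [w0|w0] := ltP 0%R (w u); last first.
  by rewrite mule0 integral0_eq// => s _; rewrite /K3/= [(0 < w u)%R]ltNge w0 andbF.
(* With s = w v, the integral of s^(-n-1) over s > w is w^(-n) [radial_mass], which cancels the
   factor w^n of [K3]. *)
transitivity (\int[leb]_s ((h (w u) * f (pt u) / w u)%:E *
     (EFin \o radial_density m) ((w u)^-1 * s + 0)%R)).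
  apply: eq_integral => s _; rewrite /K3/= /radial_density addr0 w0/= -EFinM.
  rewrite -[in X in _ = (_ * (if X then _ else _))%:E]ltr_pdivrMl ?invr_gt0// invrK mulr1.
  have [ws|ws] := ltP (w u) s; last by rewrite andbF mulr0.
  rewrite (lt_trans w0 ws)/=; congr EFin; rewrite invfM invrK exprMn [in RHS]exprS.
  by field; rewrite gt_eqF// (lt_trans w0).
rewrite ge0_integralZl//; last 3 first.
- exact: (measurableT_comp (measurable_radial_density m) (measurable_affine (w u)^-1 0)).
- by move=> s _; rewrite lee_fin radial_density_ge0.
- by rewrite lee_fin mulr_ge0 ?invr_ge0 ?mulr_ge0// ltW.
have wV0 : (0 < (w u)^-1)%R by rewrite invr_gt0.
rewrite (ge0_integral_affine _ _ wV0 (EFin \o radial_density m)); last 2 first.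
- exact: measurable_radial_density.
- by move=> t; rewrite lee_fin radial_density_ge0.
by rewrite muleA -EFinM invrK divfK ?gt_eqF// muleC.
Qed.
End polar_coordinates.

(** * Integration against f as a linear functional, and its values on Gaussians *)

Section compact_support.
Context {R : realType} {n : nat}.
Implicit Types (f g : 'rV[R]_n -> R) (x y : 'rV[R]_n).

Lemma closed_norm_ball (x0 : 'rV[R]_n) (r : R) : closed [set x | `|x - x0| <= r].
Proof.
have cn : continuous (fun x : 'rV[R]_n => `|x - x0|).
  move=> x; apply: (@continuous_comp _ _ _ (fun x : 'rV[R]_n => x - x0) Num.norm).
    by apply: continuousB => //; exact: cst_continuous.
  exact: norm_continuous.
by move/continuous_closedP : cn => /(_ [set t | t <= r] (@closed_le _ r)).
Qed.

Lemma compact_norm_ball (x0 : 'rV[R]_n) (r : R) : compact [set x | `|x - x0| <= r].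
Proof.
apply: bounded_closed_compact; last exact: closed_norm_ball.
exists (`|x0| + r); split => [|M rM x /= xr]; first exact: num_real.
rewrite -[x](subrK x0) addrC (le_trans (ler_normD _ _))// ltW// (le_lt_trans _ rM)//.
by rewrite lerD2l.
Qed.

Lemma compact_norm_le (A : set 'rV[R]_n) g : compact A -> continuous g ->
  exists2 M, 0 <= M & forall x, A x -> `|g x| <= M.
Proof.
move=> cA cg; have : compact (g @` A).
  by apply: continuous_compact => //; exact: continuous_subspaceT.
move=> /compact_bounded/ex_strict_bound_gt0[M M0 /= gM]; exists M; first exact: ltW.
by move=> x Ax; apply/ltW/gM; exists x.
Qed.

Lemma compact_support_norm_le (B : R) g : continuous g ->
  (forall x, B < `|x| -> g x = 0) -> exists2 M, 0 <= M & forall x, `|g x| <= M.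
Proof.
move=> cg gB; have [M M0 gM] := compact_norm_le _ _ (compact_norm_ball 0 B) cg.
exists M => // x; have [xB|/gB->] := leP `|x| B; last by rewrite normr0.
by apply: gM; rewrite /= subr0.
Qed.

Lemma supp_neq0 f x : f x != 0 -> supp f x.
Proof. by move=> fx; apply: subset_closure. Qed.

Lemma Cc_support f : Cc f -> exists2 B, 0 <= B & forall x, B < `|x| -> f x = 0.
Proof.
move=> [_ /compact_bounded/ex_strict_bound_gt0[B B0 /= fB]]; exists B; first exact: ltW.
move=> x Bx; apply/eqP/negPn/negP => /supp_neq0 /fB.
by rewrite ltNge (ltW Bx).
Qed.

Lemma coord_le_enorm x i : `|x ord0 i| <= enorm x.
Proof.
rewrite -sqrtr_sqr; apply: ler_wsqrtr; rewrite (bigD1 i)//= lerDl.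
by apply: sumr_ge0 => j _; rewrite sqr_ge0.
Qed.

Lemma norm_le_enorm x : `|x| <= enorm x.
Proof.
rewrite [leLHS]/Num.norm/= mx_normrE; apply/bigmax_leP; split; first exact: enorm_ge0.
by move=> [i j] _ /=; rewrite ord1 coord_le_enorm.
Qed.

End compact_support.

Section gaussian_integral.
Context {R : realType} {m : nat}.
Local Notation n := m.+1.
Context d (T : measurableType d) (mu : {sigma_finite_measure set T -> \bar R})
  (pt : T -> 'rV[R]_n).
Hypothesis model : Rn_model mu pt.
Variable f : 'rV[R]_n -> R.
Hypothesis ccf : Cc f.
Local Open Scope ereal_scope.

Let cf : continuous f. Proof. by case: ccf. Qed.

Lemma compact_support_integral (g : 'rV[R]_n -> R) (B : R) : continuous g ->
  (forall x, (B < `|x|)%R -> g x = 0%R) ->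
  mu.-integrable setT (fun u => (g (pt u))%:E) /\
  Rn_integral (EFin \o g) = \int[mu]_u (g (pt u))%:E.
Proof.
move=> cg gB; have [M M0 gM] := compact_support_norm_le _ _ cg gB.
have [_ _ intb] := model.
apply: (intb (EFin \o g) M (Num.max B 0%R)) => //.
- by rewrite le_max lexx orbT.
- exact: row_measurable_EFin.
- by move=> x; rewrite gt_max => /andP[Bx _] /=; rewrite gB.
Qed.

Definition weighted_integral (G : 'rV[R]_n -> R) : R :=
  (\int[mu]_u (G (pt u) * f (pt u)))%R.

Lemma integrable_weight (G : 'rV[R]_n -> R) : continuous G ->
  mu.-integrable setT (fun u => (G (pt u) * f (pt u))%:E).
Proof.
move=> cG; have [B _ fB] := Cc_support _ ccf.
apply: (@compact_support_integral (fun x => G x * f x)%R B _ _).1.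
  by move=> x; apply: continuousM; [exact: cG|exact: cf].
by move=> x Bx; rewrite fB ?mulr0.
Qed.

Lemma weighted_integral_linear (F G : 'rV[R]_n -> R) a : continuous F -> continuous G ->
  weighted_integral (fun x => F x + a * G x)%R =
  (weighted_integral F + a * weighted_integral G)%R.
Proof.
move=> cF cG; rewrite /weighted_integral -RintegralZl//; last exact: integrable_weight.
rewrite -RintegralD//; last 2 first.
- exact: integrable_weight.
- apply: (eq_integrable measurableT (fun u => (a%:E * (G (pt u) * f (pt u))%:E))) => //.
  by apply: integrableZl => //; exact: integrable_weight.
by apply: eq_Rintegral => u _; rewrite mulrDl mulrA.
Qed.

(** The supremum of [G] is taken over [supp f] alone; this is how the distance to the support enters
    all decay estimates. *)
Lemma weighted_integral_bound (G : 'rV[R]_n -> R) M : continuous G -> (0 <= M)%R ->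
  (forall y, supp f y -> `|G y| <= M)%R ->
  (`|weighted_integral G| <= (\int[mu]_u `|f (pt u)|) * M)%R.
Proof.
move=> cG M0 GM; have [B _ fB] := Cc_support _ ccf.
have iabs (g : 'rV[R]_n -> R) : continuous g -> (forall x, (B < `|x|)%R -> g x = 0%R) ->
    mu.-integrable setT (fun u => (`|g (pt u)|)%:E).
  move=> cg gB; apply: (@compact_support_integral (fun x => `|g x|)%R B _ _).1.
    move=> x; apply: (@continuous_comp _ _ _ g Num.norm) ; [exact: cg|exact: (@norm_continuous _ R^o)].
  by move=> x Bx; rewrite gB ?normr0.
rewrite mulrC -RintegralZl//; last exact: iabs.
apply: (le_trans (le_normr_Rintegral _ _)) => //; first exact: integrable_weight.
apply: le_Rintegral => //.
- apply: (iabs (fun x => G x * f x)%R).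
    by move=> x; apply: continuousM; [exact: cG|exact: cf].
  by move=> x Bx; rewrite fB ?mulr0.
- apply: (eq_integrable measurableT (fun u => (M%:E * (`|f (pt u)|)%:E))) => //.
  by apply: integrableZl => //; exact: iabs.
move=> u _; rewrite normrM; have [->|fu] := eqVneq (f (pt u)) 0%R.
  by rewrite normr0 !mulr0.
by rewrite ler_wpM2r// GM//; exact: supp_neq0.
Qed.
End gaussian_integral.
Arguments weighted_integral {R m d T} mu pt f G.

Section sphere_to_gaussian.
Context {R : realType} {m : nat}.
Local Notation n := m.+1.
Context d (T : measurableType d) (mu : {sigma_finite_measure set T -> \bar R})
  (pt : T -> 'rV[R]_n).
Hypothesis model : Rn_model mu pt.
Local Open Scope ereal_scope.
Local Notation leb := (@lebesgue_measure R).

(** The integral in [sphere_integral] without the factor n r^(n-1); up to a constant it is the mean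
    of [g] over the sphere. *)
Definition sphere_mean (g : 'rV[R]_n -> R) (p : 'rV[R]_n) (r : R) : \bar R :=
  Rn_integral (fun x => if ((0 < enorm x) && (enorm x < 1))%R
                        then (g (p + (r / enorm x) *: x)%R)%:E else 0).

Lemma enorm_eq0 k (x : 'rV[R]_k) : enorm x = 0%R -> x = 0%R.
Proof.
move=> x0; apply/rowP => i; rewrite mxE; apply/eqP.
by rewrite -normr_le0 -x0 coord_le_enorm.
Qed.

Lemma continuous_shift (g : 'rV[R]_n -> R) (p : 'rV[R]_n) : continuous g ->
  continuous (fun x => g (p + x)%R).
Proof.
move=> cg x; apply: (@continuous_comp _ _ _ (fun x : 'rV[R]_n => (p + x)%R) g).
  by apply: continuousD; [exact: cst_continuous|].
exact: cg.
Qed.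

Lemma continuous_enorm_sub (p : 'rV[R]_n) : continuous (fun y : 'rV[R]_n => enorm (y - p)).
Proof.
move=> x; apply: (@continuous_comp _ _ _ (fun x : 'rV[R]_n => x - p)%R (@enorm R n)).
  by apply: continuousB => //; exact: cst_continuous.
exact: continuous_enorm.
Qed.

(** Polar coordinates skip the centre; [g p = 0] makes the two integrands agree there too, so no
    null set has to be discussed. *)
Lemma sphere_mean_polar (h : R -> R) (g : 'rV[R]_n -> R) (p : 'rV[R]_n) :
  continuous h -> (forall r, 0 <= h r)%R -> continuous g -> (forall x, 0 <= g x)%R ->
  g p = 0%R ->
  \int[leb]_r ((if (0 < r)%R then r ^+ m * h r else 0)%R%:E * sphere_mean g p r) =
  radial_mass m * \int[mu]_u (h (enorm (pt u - p)) * g (pt u))%:E.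
Proof.
move=> ch h0 cg g0 gp; have [_ int0 _] := model.
rewrite (@polar_coordinates R m d T mu pt model h (fun x => g (p + x)%R) h0
  (continuous_measurable_fun ch) (fun x => g0 _) (continuous_shift g p cg)).
pose G y := (h (enorm (y - p)) * g y)%:E.
have mG : row_measurable G.
  apply: row_measurable_EFin => y; apply: continuousM; last exact: cg.
  apply: (@continuous_comp _ _ _ (fun y : 'rV[R]_n => enorm (y - p)%R) h).
    exact: continuous_enorm_sub.
  exact: ch.
have G0 y : 0 <= G y by rewrite lee_fin mulr_ge0.
congr (_ * _); rewrite -(int0 G)//.
have := Rn_integral_affine G 1 p ltr01 mG G0.
rewrite invr1 expr1n mul1e => <-; congr Rn_integral; apply/funext => x.
rewrite /G scale1r addrK; case: ltP => [_|x0]; first by rewrite addrC.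
have -> : x = 0%R by apply: enorm_eq0; apply/eqP; rewrite eq_le x0 enorm_ge0.
by rewrite add0r gp mulr0.
Qed.

Lemma sphere_mean_integrable (g : 'rV[R]_n -> R) p r M : continuous g ->
  (0 <= M)%R -> (forall x, `|g x| <= M)%R ->
  let k x := (if ((0 < enorm x) && (enorm x < 1))%R
              then g (p + (r / enorm x) *: x) else 0)%R in
  mu.-integrable setT (fun u => (k (pt u))%:E) /\
  sphere_mean g p r = \int[mu]_u (k (pt u))%:E.
Proof.
move=> cg M0 gM k; have [_ _ intb] := model.
have -> : sphere_mean g p r = Rn_integral (EFin \o k).
  by congr Rn_integral; apply/funext => x; rewrite /k/=; case: ifP.
apply: (intb (EFin \o k) M 1%R) => //.
- move=> d' X phi mphi.
  have mn : measurable_fun setT (fun x => enorm (phi x)).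
    exact: (@measurable_continuous_rV R n _ _ phi _ mphi continuous_enorm).
  apply/measurable_EFinP; apply: measurable_fun_ifT => //.
    by apply: measurable_and; exact: measurable_fun_ltr.
  apply: (@measurable_continuous_rV _ _ _ _ (fun x => p + (r / enorm (phi x)) *: phi x)%R) => // i.
  under eq_fun do rewrite !mxE.
  apply: measurable_funD => //; apply: measurable_funM => //.
  by apply: measurable_funM => //; exact: (measurableT_comp (measurable_invr R) mn).
- by move=> x; rewrite /k/= lee_fin; case: ifP => // _; rewrite normr0.
- move=> x x1; rewrite /k/= [(enorm x < 1)%R]ltNge (ltW (lt_le_trans x1 (norm_le_enorm x))).
  by rewrite andbF.
Qed.

Lemma gaussian_vanishing (f : 'rV[R]_n -> R) (p : 'rV[R]_n) (s : R) : Cc f ->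
  f p = 0%R -> (forall r, (0 < r)%R -> spherical_transform f p r = 0) ->
  weighted_integral mu pt f (fun y => expR (- s * enorm (y - p) ^+ 2)) = 0%R.
Proof.
move=> ccf fp fS; have cf : continuous f by case: ccf.
have [B B0 fB] := Cc_support _ ccf.
have [M M0 fM] := compact_support_norm_le _ _ cf fB.
(* The positive and negative parts of [f], since [sphere_mean_polar] is about
   nonnegative functions. *)
pose part (e : R) y := ((`|f y| + e * f y) / 2)%R.
have cpart e : continuous (part e).
  move=> y; apply: (@continuousM _ _ (fun y => `|f y| + e * f y) (fun=> 2^-1))%R; last exact: cst_continuous.
  apply: (@continuousD _ _ _ (fun y => `|f y|) (fun y => e * f y))%R.
    apply: (@continuous_comp _ _ _ f Num.norm); [exact: cf|exact: (@norm_continuous _ R^o)].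
  by apply: continuousM; [exact: cst_continuous|exact: cf].
have part0 e y : `|e|%R = 1%R -> (0 <= part e y)%R.
  move=> e1; rewrite /part divr_ge0// -[(`|f y|)%R]mul1r -e1 -normrM.
  by have := ler_norm (- (e * f y))%R; rewrite normrN; lra.
have partM e y : `|e|%R = 1%R -> (`|part e y| <= M)%R.
  move=> e1; rewrite ger0_norm ?part0// /part ler_pdivrMr// mulrDr mulr1.
  rewrite lerD// (le_trans (ler_norm _))// normrM e1 mul1r//.
have partB e y : (B < `|y|)%R -> part e y = 0%R.
  by move=> By; rewrite /part fB// normr0 mulr0 addr0 mul0r.
have partp e : part e p = 0%R by rewrite /part fp normr0 mulr0 addr0 mul0r.
pose h (r : R) := expR (- s * r ^+ 2).
have ch : continuous h.
  rewrite /h => r; apply: (@continuous_comp _ _ _ (fun r : R => - s * r ^+ 2)%R expR).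
    by apply: continuousM; [exact: cst_continuous|exact: exprn_continuous].
  exact: continuous_expR.
have n1 : `|1 : R|%R = 1%R by rewrite normr1.
have nN1 : `|-1 : R|%R = 1%R by rewrite normrN1.
(* As f is the difference of its two parts, its vanishing spherical integrals say that the parts
   have equal ones; polar coordinates then give them equal Gaussian integrals. *)
have meanE r : (0 < r)%R -> sphere_mean (part 1%R) p r = sphere_mean (part (-1)%R) p r.
  move=> r0.
  have [i1 E1] := sphere_mean_integrable _ p r M (cpart 1%R) M0 (fun y => partM _ y n1).
  have [i2 E2] := sphere_mean_integrable _ p r M (cpart (-1)%R) M0 (fun y => partM _ y nN1).
  have [_ E] := sphere_mean_integrable _ p r M cf M0 fM.
  have : sphere_mean f p r = 0.
    have /eqP := fS r r0; rewrite /spherical_transform /sphere_integral mule_eq0.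
    by rewrite eqe mulrn_eq0/= expf_eq0 gt_eqF// andbF/= => /eqP.
  rewrite E; under eq_integral.
    move=> u _; rewrite (_ : (if _ then _ else _) =
      (if (0 < enorm (pt u) < 1)%R then part 1%R (p + (r / enorm (pt u)) *: pt u)%R else 0%R)
      - (if (0 < enorm (pt u) < 1)%R then part (-1)%R (p + (r / enorm (pt u)) *: pt u)%R else 0%R))%R.
      over.
    by case: ifP => _; rewrite /part; lra.
  under eq_integral do rewrite EFinB.
  rewrite integralB_EFin// -E1 -E2 => S12.
  have F2 : sphere_mean (part (-1)%R) p r \is a fin_num.
    by rewrite E2; exact: integrable_fin_num.
  by rewrite -(subeK (sphere_mean (part 1%R) p r) F2) S12 add0e.
have h0 r : (0 <= h r)%R by rewrite expR_ge0.
have P1 := sphere_mean_polar h _ p ch h0 (cpart 1%R) (fun y => part0 _ y n1) (partp _).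
have P2 := sphere_mean_polar h _ p ch h0 (cpart (-1)%R) (fun y => part0 _ y nN1) (partp _).
have {P1 P2} : radial_mass m * \int[mu]_u (h (enorm (pt u - p)) * part 1 (pt u))%:E =
    radial_mass m * \int[mu]_u (h (enorm (pt u - p)) * part (-1) (pt u))%:E.
  rewrite -P1 -P2; apply: eq_integral => r _.
  by case: ifPn => [r0|_]; [rewrite meanE|rewrite !mul0e].
have int_part e : mu.-integrable setT (fun u => (h (enorm (pt u - p)) * part e (pt u))%:E).
  apply: (@compact_support_integral _ _ _ _ _ _ model (fun y => h (enorm (y - p)) * part e y)%R B _ _).1.
    move=> y; apply: (@continuousM R 'rV[R]_n (fun y => h (enorm (y - p))%R) (part e)); last exact: cpart.
    apply: (@continuous_comp _ _ _ (fun y : 'rV[R]_n => enorm (y - p)%R) h).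
      exact: continuous_enorm_sub.
    exact: ch.
  by move=> y By; rewrite partB// mulr0.
have c0 := @radial_mass_gt0 R m; have cy := @radial_mass_lty R m.
have [c cE] : exists c : R, radial_mass m = c%:E.
  by exists (fine (radial_mass m)); rewrite fineK// ge0_fin_numE// ltW.
have fin_part e : \int[mu]_u (h (enorm (pt u - p)) * part e (pt u))%:E \is a fin_num.
  exact: integrable_fin_num (int_part e).
rewrite cE -(fineK (fin_part 1%R)) -(fineK (fin_part (-1)%R)) -!EFinM => -[].
have c_neq0 : (c != 0)%R by move: c0; rewrite cE lte_fin => /gt_eqF ->.
move=> /(mulfI c_neq0) eqpart.
rewrite /weighted_integral; under eq_Rintegral.
  move=> u _; rewrite (_ : (_ * _)%R = (h (enorm (pt u - p)) * part 1 (pt u) -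
     h (enorm (pt u - p)) * part (-1) (pt u))%R); first over.
  by rewrite /part /h; lra.
rewrite RintegralB//; [|exact: int_part..].
by rewrite /Rintegral eqpart subrr.
Qed.
End sphere_to_gaussian.

Section lower_bound.
Context {R : realType} {m : nat}.
Local Notation n := m.+1.
Context d (T : measurableType d) (mu : {sigma_finite_measure set T -> \bar R})
  (pt : T -> 'rV[R]_n).
Hypothesis model : Rn_model mu pt.
Local Open Scope ereal_scope.

(** A cube is a ball for the max norm, so its volume is explicit and no volume of a Euclidean ball
    is needed. *)
Definition row_box (y0 : 'rV[R]_n) (a : R) (y : 'rV[R]_n) : R :=
  (if `|y - y0| <= a then 1 else 0)%R.

Lemma row_boxE (y0 : 'rV[R]_n) a (x : nat -> R) : (0 <= a)%R ->
  row_box y0 a (\row_i x i) = box (fun j => if insub j is Some i then y0 ord0 i else 0)%R a n x.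
Proof.
move=> a0; rewrite /row_box /box.
have [xa|xa] := boolP [forall j : 'I_n, `|x j - y0 ord0 j| <= a]%R.
  rewrite big1 => [|j _]; last by rewrite valK; move/forallP: xa => ->.
  case: ifPn => // /negP[]; rewrite [leLHS]/Num.norm/= mx_normrE; apply/bigmax_leP.
  by split=> // -[i j] _ /=; rewrite ord1 !mxE; move/forallP: xa => ->.
have [j xj] := forallPn xa.
rewrite (bigD1 j)//= valK (negbTE xj) mul0r; case: ifPn => // xy.
have := le_trans (le_coord_norm (\row_i x i - y0)%R j) xy.
by rewrite !mxE (negbTE xj).
Qed.

Lemma row_box_integral (y0 : 'rV[R]_n) (a c : R) : (0 <= a)%R -> (0 <= c)%R ->
  mu.-integrable setT (fun u => (c * row_box y0 a (pt u))%:E) /\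
  (\int[mu]_u (c * row_box y0 a (pt u)) = c * (2 * a) ^+ n)%R.
Proof.
move=> a0 c0; have [_ _ intb] := model.
have [i E] : mu.-integrable setT (fun u => (c * row_box y0 a (pt u))%:E) /\
    Rn_integral (fun y => (c * row_box y0 a y)%:E) = \int[mu]_u (c * row_box y0 a (pt u))%:E.
  apply: (intb (fun y => (c * row_box y0 a y)%:E) c (`|y0| + a)%R) => //.
  - by rewrite addr_ge0.
  - move=> d' X phi mphi; apply/measurable_EFinP; apply: measurable_funM => //.
    apply: measurable_fun_ifT => //; apply: measurable_fun_ler => //.
    apply: (@measurable_continuous_rV R n _ _ phi (fun y => `|y - y0|)%R mphi) => y.
    apply: (@continuous_comp _ _ _ (fun y : 'rV[R]_n => y - y0)%R Num.norm).
      by apply: continuousB => //; exact: cst_continuous.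
    exact: norm_continuous.
  - move=> y; rewrite lee_fin ger0_norm; last first.
      by rewrite mulr_ge0// /row_box; case: ifP.
    by rewrite /row_box; case: ifP; rewrite ?mulr1 ?mulr0.
  - move=> y yB; rewrite /row_box; case: ifPn; rewrite ?mulr0// => yy0.
    move: yB; rewrite ltNge -[y](subrK y0) (le_trans (ler_normD _ _))//.
    by rewrite addrC lerD2l.
split=> //; rewrite /Rintegral -E /Rn_integral.
under [X in iter_int _ X]funext do rewrite row_boxE//.
by rewrite iter_int_box.
Qed.

(** Integrate the pointwise bound a e 1_cube <= sg(f y0) G f + b |f|, where [e] is half of |f y0|
    and the cube around [y0] is small enough that sg(f y0) f >= e on it. The term in [b] pays for
    the points where f has the opposite sign. The constant [w] depends on [f], [y0], [r] and not on
    [G]. *)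
Lemma weighted_integral_lower (f : 'rV[R]_n -> R) (y0 : 'rV[R]_n) (r : R) : Cc f ->
  f y0 != 0%R -> (0 < r)%R -> exists2 w, (0 < w)%R &
  forall (G : 'rV[R]_n -> R) (a b : R), continuous G -> (0 <= a)%R -> (0 <= b)%R ->
    (forall y, 0 <= G y)%R -> (forall y, `|y - y0| <= r -> a <= G y)%R ->
    (forall y, f y * f y0 < 0 -> G y <= b)%R ->
    (w * a <= `|weighted_integral mu pt f G| + (\int[mu]_u `|f (pt u)|) * b)%R.
Proof.
move=> ccf fy0 r0; have cf : continuous f by case: ccf.
have [B B0 fB] := Cc_support _ ccf.
pose e := (`|f y0| / 2)%R.
have e0 : (0 < e)%R by rewrite divr_gt0// normr_gt0.
have [r' /andP[r'0 r'r] fr'] : exists2 r', (0 < r' <= r)%R &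
    forall y, (`|y - y0| <= r' -> e <= Num.sg (f y0) * f y)%R.
  have /cvgrPdist_lt /(_ e e0) /nbhs_ballP[k /= k0 kf] := cf y0.
  exists (Num.min r (k / 2))%R; first by rewrite lt_min r0 divr_gt0//= ge_min lexx.
  move=> y; rewrite le_min => /andP[_ yk].
  have : (`|f y0 - f y| < e)%R.
    apply: kf; rewrite -ball_normE /ball_/= distrC (le_lt_trans yk)//.
    by rewrite ltr_pdivrMr// mulr2n mulrDr mulr1 ltrDl.
  have -> : `|f y0 - f y|%R = `|Num.sg (f y0) * (f y0 - f y)|%R.
    by rewrite normrM normr_sg fy0 mul1r.
  rewrite mulrBr -normrEsg; have := ler_norm (`|f y0| - Num.sg (f y0) * f y)%R.
  by rewrite /e; lra.
exists (e * (2 * r') ^+ n)%R; first by rewrite mulr_gt0// exprn_gt0// mulr_gt0.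
move=> G a b cG a0 b0 G0 Ga Gb.
have [ib Eb] := row_box_integral y0 r' (a * e) (ltW r'0) (mulr_ge0 a0 (ltW e0)).
have iG : mu.-integrable setT (fun u => (G (pt u) * f (pt u))%:E).
  exact: integrable_weight.
have iN : mu.-integrable setT (fun u => (`|f (pt u)|)%:E).
  apply: (@compact_support_integral _ _ _ _ _ _ model (fun x => `|f x|)%R B _ _).1.
    move=> x; apply: (@continuous_comp _ _ _ f Num.norm); [exact: cf|exact: (@norm_continuous _ R^o)].
  by move=> x Bx; rewrite fB ?normr0.
have isG : mu.-integrable setT (fun u => (Num.sg (f y0) * (G (pt u) * f (pt u)))%:E).
  apply: (eq_integrable measurableT (fun u => (Num.sg (f y0))%:E * (G (pt u) * f (pt u))%:E)) => //.
  exact: integrableZl.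
have ibN : mu.-integrable setT (fun u => (b * `|f (pt u)|)%:E).
  apply: (eq_integrable measurableT (fun u => b%:E * (`|f (pt u)|)%:E)) => //.
  exact: integrableZl.
have key : (\int[mu]_u (a * e * row_box y0 r' (pt u)) <=
    \int[mu]_u (Num.sg (f y0) * (G (pt u) * f (pt u)) + b * `|f (pt u)|))%R.
  apply: le_Rintegral => //.
    apply: (eq_integrable measurableT (fun u => (Num.sg (f y0) * (G (pt u) * f (pt u)))%:E +
      (b * `|f (pt u)|)%:E)) => //.
    exact: integrableD.
  move=> u _; move: (pt u) => y; rewrite /row_box.
  have bf : (0 <= b * `|f y|)%R by rewrite mulr_ge0.
  case: ifPn => [yr'|_].
    have aG : (a <= G y)%R by apply: Ga; rewrite (le_trans yr').
    by rewrite mulr1 -[leLHS]addr0 lerD// [leRHS]mulrCA ler_pM ?fr' ?(ltW e0).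
  rewrite mulr0; have [yy0|yy0] := ltP (f y * f y0)%R 0%R.
    have -> : (Num.sg (f y0) * (G y * f y) = - (G y * `|f y|))%R.
      move: yy0; have [fp|fp|->] := ltgtP (f y0) 0%R; last by rewrite mulr0 ltxx.
      + by rewrite nmulr_llt0// => fy; rewrite ltr0_sg// gtr0_norm// mulN1r.
      + by rewrite pmulr_llt0// => fy; rewrite gtr0_sg// ltr0_norm// mul1r mulrN opprK.
    by rewrite addrC subr_ge0 ler_wpM2r// Gb.
  rewrite addr_ge0// [leRHS]mulrCA mulr_ge0//.
  move: yy0; have [fp|fp|->] := ltgtP (f y0) 0%R; last by rewrite sgr0 mul0r.
  + by rewrite nmulr_lge0// => fy; rewrite ltr0_sg// mulN1r oppr_ge0.
  + by rewrite pmulr_lge0// => fy; rewrite gtr0_sg// mul1r.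
rewrite mulrAC [(e * a)%R]mulrC -Eb (le_trans key)// RintegralD// RintegralZl// RintegralZl//.
rewrite [leRHS]addrC [leLHS]addrC mulrC lerD2l (le_trans (ler_norm _))//.
by rewrite normrM normr_sg fy0 mul1r.
Qed.
End lower_bound.

(** The interface between integration and the rest: from here on [I] is an abstract functional with
    these properties, and no measure appears. *)
Lemma spherical_functional (R : realType) (m : nat) (f : 'rV[R]_m.+1 -> R) : Cc f ->
  exists (I : ('rV[R]_m.+1 -> R) -> R) (L : R), [/\ 0 <= L,
    forall (F G : 'rV[R]_m.+1 -> R) a, continuous F -> continuous G -> I (fun x => F x + a * G x) = I F + a * I G,
    forall (G : 'rV[R]_m.+1 -> R) M, continuous G -> 0 <= M -> (forall y, supp f y -> `|G y| <= M) ->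
      `|I G| <= L * M,
    forall p s, f p = 0 -> (forall r, 0 < r -> spherical_transform f p r = 0%E) ->
      I (fun y => expR (- s * enorm (y - p) ^+ 2)) = 0 &
    forall y0 r, f y0 != 0 -> 0 < r -> exists2 w, 0 < w &
      forall (G : 'rV[R]_m.+1 -> R) (a b : R), continuous G -> 0 <= a -> 0 <= b ->
        (forall y, 0 <= G y) -> (forall y, `|y - y0| <= r -> a <= G y) ->
        (forall y, f y * f y0 < 0 -> G y <= b) -> w * a <= `|I G| + L * b].
Proof.
move=> ccf; have [d [T [mu [pt model]]]] := @Rn_modelP R m.+1.
exists (weighted_integral mu pt f), (\int[mu]_u `|f (pt u)|); split.
- exact: Rintegral_ge0.
- by move=> F G a cF cG; exact: weighted_integral_linear.
- by move=> G M cG M0 GM; exact: weighted_integral_bound.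
- by move=> p s fp fS; exact: gaussian_vanishing.
- by move=> y0 r fy0 r0; exact: weighted_integral_lower.
Qed.

(** * Maximum principle for Gaussian integrals *)

Section exponential_estimates.
Context {R : realType}.
Implicit Types x t a b : R.

(** Termwise comparison of the two tails, passed to the limit. The estimate holds for every real
    [x], which the large arguments in [cutoff_taylor] require. *)
Lemma expR_taylor (N : nat) x :
  `|expR x - \sum_(0 <= k < N) exp_coeff x k| <=
  expR `|x| - \sum_(0 <= k < N) exp_coeff `|x| k.
Proof.
have cx := @is_cvg_series_exp_coeff R x.
have ca := @is_cvg_series_exp_coeff R `|x|.
have L1 : `|series (exp_coeff x) M - \sum_(0 <= k < N) exp_coeff x k| @[M --> \oo] -->
    `|expR x - \sum_(0 <= k < N) exp_coeff x k|.
  by apply: cvg_norm; apply: cvgB => //; exact: cvg_cst.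
have L2 : series (exp_coeff `|x|) M - \sum_(0 <= k < N) exp_coeff `|x| k @[M --> \oo] -->
    expR `|x| - \sum_(0 <= k < N) exp_coeff `|x| k.
  by apply: cvgB => //; exact: cvg_cst.
apply: (ler_cvg_to L1 L2); near=> M.
have NM : (N <= M)%N by near: M; exact: nbhs_infty_ge.
rewrite /series/= !(big_cat_nat (leq0n N) NM)/= ![_ + \sum_(N <= k < M) _]addrC !addrK.
apply: (le_trans (ler_norm_sum _ _ _)); apply: ler_sum => k _.
by rewrite !exp_coeffE normrM normrX ger0_norm// invr_ge0.
Unshelve. all: by end_near. Qed.

Lemma expR_taylor_small (N : nat) x : `|x| <= 1 ->
  `|expR x - \sum_(0 <= k < N) exp_coeff x k| <= expR 1 * `|x| ^+ N.
Proof.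
move=> x1; apply: (le_trans (expR_taylor N x)).
have ca := @is_cvg_series_exp_coeff R `|x|.
have L2 : series (exp_coeff `|x|) M - \sum_(0 <= k < N) exp_coeff `|x| k @[M --> \oo] -->
    expR `|x| - \sum_(0 <= k < N) exp_coeff `|x| k.
  by apply: cvgB => //; exact: cvg_cst.
have L1 : series (exp_coeff (1 : R)) M * `|x| ^+ N @[M --> \oo] --> expR 1 * `|x| ^+ N.
  by apply: cvgM; [exact: is_cvg_series_exp_coeff|exact: cvg_cst].
apply: (ler_cvg_to L2 L1); near=> M.
have NM : (N <= M)%N by near: M; exact: nbhs_infty_ge.
rewrite /series/= !(big_cat_nat (leq0n N) NM)/= ![_ + \sum_(N <= k < M) _]addrC addrK.
rewrite mulrDl -[leLHS]addr0 lerD//; last first.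
  by rewrite mulr_ge0 ?exprn_ge0// sumr_ge0// => k _; rewrite exp_coeff_ge0.
rewrite big_distrl/= big_nat_cond [leRHS]big_nat_cond.
apply: ler_sum => k /andP[/andP[Nk _] _].
rewrite !exp_coeffE expr1n mulr1 ler_wpM2l ?invr_ge0//.
by rewrite ler_wiXn2l// normr_ge0.
Unshelve. all: by end_near. Qed.

Lemma expR_dist_le x y : 0 <= x -> 0 <= y -> `|expR (- x) - expR (- y)| <= `|x - y|.
Proof.
wlog xy : x y / x <= y => [H x0 y0|x0 y0].
  have [xy|/ltW yx] := leP x y; first exact: H.
  by rewrite distrC [leRHS]distrC; exact: H.
rewrite ger0_norm ?subr_ge0 ?ler_expR ?lerN2// distrC ger0_norm ?subr_ge0//.
have -> : expR (- y) = expR (- x) * expR (x - y) by rewrite -expRD; congr expR; lra.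
have := expR_ge1Dx (x - y); have : expR (- x) <= 1 by rewrite -expR0 ler_expR; lra.
have := expR_gt0 (- x).
nra.
Qed.

Lemma expR_quadratic x : `|x| <= 1 -> `|expR x - 1 - x - x ^+ 2 / 2| <= expR 1 * `|x| ^+ 3.
Proof.
move=> x1; have := expR_taylor_small 3 x x1.
rewrite !big_nat_recr//= big_nil !exp_coeffE/= !factS fact0 expr0 expr1.
by congr (`|_| <= _); field.
Qed.

(** The odd terms in [t] cancel. [C] collects the two cubic remainders and the leftover t^4 b^2; it
    depends on [M] only, as [a] and [b] will vary with the integration variable. *)
Lemma expR_second_difference M : 0 <= M -> exists2 C, 0 <= C &
  forall t a b, 0 <= t -> t <= 1 -> t * (2 * M) <= 1 -> `|a| <= M -> `|b| <= M ->
  `|expR (t * a + t ^+ 2 * b) + expR (- (t * a) + t ^+ 2 * b) - 2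
    - t ^+ 2 * (a ^+ 2 + 2 * b)| <= C * t ^+ 3.
Proof.
move=> M0; exists (M ^+ 2 + 2 * (expR 1 * (2 * M) ^+ 3)).
  by rewrite addr_ge0 ?sqr_ge0// !mulr_ge0// ?expR_ge0// exprn_ge0// mulr_ge0.
move=> t a b t0 t1 tM aM bM.
have tt : t ^+ 2 <= t by rewrite expr2 ler_piMl.
have small c : `|c| <= M -> `|t * c + t ^+ 2 * b| <= t * (2 * M).
  move=> cM; rewrite (le_trans (ler_normD _ _))// (normrM t c) (normrM (t ^+ 2) b) (ger0_norm t0).
  rewrite (ger0_norm (sqr_ge0 t)).
  have : t * `|c| <= t * M by rewrite ler_wpM2l.
  have : t ^+ 2 * `|b| <= t * M by rewrite ler_pM ?sqr_ge0.
  lra.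
have cube c : `|c| <= M -> `|t * c + t ^+ 2 * b| ^+ 3 <= (2 * M) ^+ 3 * t ^+ 3.
  move=> cM; rewrite -exprMn [_ * t]mulrC lerXn2r ?nnegrE ?small//.
  by rewrite !mulr_ge0.
set x := t * a + _; set y := - (t * a) + _.
have xs : `|x| <= t * (2 * M) by exact: small.
have yE : y = t * - a + t ^+ 2 * b by rewrite /y mulrN.
have ys : `|y| <= t * (2 * M) by rewrite yE; apply: small; rewrite normrN.
have xc : `|x| ^+ 3 <= (2 * M) ^+ 3 * t ^+ 3 by exact: cube.
have yc : `|y| ^+ 3 <= (2 * M) ^+ 3 * t ^+ 3 by rewrite yE; apply: cube; rewrite normrN.
have qx := expR_quadratic x (le_trans xs tM).
have qy := expR_quadratic y (le_trans ys tM).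
have -> : expR x + expR y - 2 - t ^+ 2 * (a ^+ 2 + 2 * b) =
   (expR x - 1 - x - x ^+ 2 / 2) + (expR y - 1 - y - y ^+ 2 / 2) + t ^+ 4 * b ^+ 2.
  by rewrite /x /y; field.
rewrite (le_trans (ler_normD _ _))// [leRHS]mulrDl addrC lerD//.
  rewrite normrM !normrX (ger0_norm t0) mulrC ler_pM ?exprn_ge0 ?normr_ge0//.
    by rewrite lerXn2r ?nnegrE ?normr_ge0.
  by rewrite ler_wiXn2l.
rewrite (le_trans (ler_normD _ _))//.
rewrite mulr_natl mulr2n mulrDl lerD//.
  by rewrite (le_trans qx)// -mulrA ler_wpM2l ?expR_ge0.
by rewrite (le_trans qy)// -mulrA ler_wpM2l ?expR_ge0.
Qed.

Lemma expR_first_difference M : 0 <= M -> exists2 C, 0 <= C &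
  forall t b, 0 <= t -> t <= 1 -> t * M <= 1 -> `|b| <= M ->
  `|expR (t ^+ 2 * b) - 1 - t ^+ 2 * b| <= C * t ^+ 3.
Proof.
move=> M0; exists (expR 1 * M ^+ 2); first by rewrite mulr_ge0 ?expR_ge0// sqr_ge0.
move=> t b t0 t1 tM bM.
have tt : t ^+ 2 <= t by rewrite expr2 ler_piMl.
have tb : `|t ^+ 2 * b| <= t ^+ 2 * M.
  by rewrite normrM (ger0_norm (sqr_ge0 t)) ler_wpM2l ?sqr_ge0.
have small : `|t ^+ 2 * b| <= 1.
  by rewrite (le_trans tb)// (le_trans _ tM)// ler_wpM2r.
have := expR_taylor_small 2 _ small.
rewrite !big_nat_recr//= big_nil !exp_coeffE/= !factS fact0 expr0 expr1 => h.
have -> : expR (t ^+ 2 * b) - 1 - t ^+ 2 * b =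
  expR (t ^+ 2 * b) - (0 + 1%:R^-1 * 1 + (1 * 1)%N%:R^-1 * (t ^+ 2 * b)) by field.
rewrite (le_trans h)// -[leRHS]mulrA ler_wpM2l ?expR_ge0//.
have : `|t ^+ 2 * b| ^+ 2 <= (t ^+ 2 * M) ^+ 2 by rewrite lerXn2r ?nnegrE ?mulr_ge0 ?sqr_ge0.
move=> /le_trans; apply; have -> : (t ^+ 2 * M) ^+ 2 = M ^+ 2 * t ^+ 4 by ring.
by rewrite ler_wpM2l ?sqr_ge0// ler_wiXn2l.
Qed.
End exponential_estimates.

Section squared_norm.
Context {R : realType} {n : nat}.
Implicit Types (x y p : 'rV[R]_n) (t : R).

Definition sqn x : R := \sum_(i < n) x ord0 i ^+ 2.
Definition dot x y : R := \sum_(i < n) x ord0 i * y ord0 i.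

Lemma sqn_ge0 x : 0 <= sqn x.
Proof. by apply: sumr_ge0 => i _; rewrite sqr_ge0. Qed.

Lemma sqnB x y : sqn (x - y) = sqn x - 2 * dot x y + sqn y.
Proof.
rewrite /sqn /dot mulr_sumr -sumrN -!big_split/=; apply: eq_bigr => i _.
by rewrite !mxE; ring.
Qed.

Lemma sqnD_delta x t (i : 'I_n) : sqn (x + t *: delta_mx ord0 i) =
  sqn x + 2 * t * x ord0 i + t ^+ 2.
Proof.
rewrite /sqn (bigD1 i)//= [in RHS](bigD1 i)//= !mxE !eqxx/= mulr1.
rewrite (eq_bigr (fun j => x ord0 j ^+ 2)).
  by set S := \sum_(_ | _) _; ring.
by move=> j ji; rewrite !mxE (negbTE ji) andbF mulr0 addr0.
Qed.

Lemma sqn_le x M : (forall i, `|x ord0 i| <= M) -> sqn x <= n%:R * M ^+ 2.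
Proof.
move=> xM; rewrite mulr_natl -[in leRHS](card_ord n) -sumr_const.
apply: ler_sum => i _; rewrite -(real_normK (num_real (x ord0 i))).
by rewrite lerXn2r ?nnegrE ?normr_ge0// (le_trans (normr_ge0 (x ord0 i))).
Qed.

Lemma continuous_sqn : continuous sqn.
Proof.
apply: continuous_big => [|i _ x]; first exact: add_continuous.
apply: (@continuous_comp _ _ _ (fun x : 'rV[R]_n => x ord0 i) (fun r => r ^+ 2)).
  exact: coord_continuous.
exact: exprn_continuous.
Qed.

Lemma continuous_sqn_sub p : continuous (fun y => sqn (y - p)).
Proof.
move=> x; apply: (@continuous_comp _ _ _ (fun x : 'rV[R]_n => x - p) sqn).
  by apply: continuousB => //; exact: cst_continuous.
exact: continuous_sqn.
Qed.

Definition gauss (s : R) p y : R := expR (- s * sqn (y - p)).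

Lemma continuous_gauss s p : continuous (gauss s p).
Proof.
move=> y; apply: (@continuous_comp _ _ _ (fun y => - s * sqn (y - p)) expR).
  by apply: (@continuousM _ _ (fun=> - s) (fun y => sqn (y - p)));
    [exact: cst_continuous|exact: continuous_sqn_sub].
exact: continuous_expR.
Qed.

End squared_norm.

Section heat_inequality.
Context {R : realType} {n : nat}.
Local Notation E := 'rV[R]_n.
Variables (I : (E -> R) -> R) (L : R) (K : set E) (B : R).
Hypothesis L0 : 0 <= L.
Hypothesis I_linear : forall (F G : E -> R) a, continuous F -> continuous G ->
  I (fun x => F x + a * G x) = I F + a * I G.
Hypothesis I_bound : forall (G : E -> R) M, continuous G -> 0 <= M ->
  (forall y, K y -> `|G y| <= M) -> `|I G| <= L * M.
Hypothesis KB : forall y i, K y -> `|y ord0 i| <= B.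
Hypothesis B0 : 0 <= B.

Local Notation A := (fun (s : R) (p : E) => I (gauss s p)).
Local Notation e_ := (delta_mx ord0).

Lemma I_zero : I (fun=> 0) = 0.
Proof.
have c0 : continuous (fun _ : E => 0 : R) by exact: cst_continuous.
transitivity (I (fun x => 0 + -1 * 0)).
  by congr I; apply/funext => x; rewrite mulr0 addr0.
by rewrite I_linear// mulN1r subrr.
Qed.

Lemma I_add (F G : E -> R) : continuous F -> continuous G ->
  I (fun x => F x + G x) = I F + I G.
Proof.
move=> cF cG; rewrite -[I G]mul1r -I_linear//.
by congr I; apply/funext => x; rewrite mul1r.
Qed.

Lemma I_scale (F : E -> R) a : continuous F -> I (fun x => a * F x) = a * I F.
Proof.
move=> cF; have c0 : continuous (fun _ : E => 0 : R) by exact: cst_continuous.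
rewrite -[RHS]add0r -[X in X + _]I_zero -I_linear//.
by congr I; apply/funext => x; rewrite add0r.
Qed.

Lemma I_sum (J : finType) (F : J -> E -> R) : (forall j, continuous (F j)) ->
  I (fun x => \sum_j F j x) = \sum_j I (F j).
Proof.
move=> cF; elim: (index_enum J) => [|j r IH].
  by under eq_fun do rewrite big_nil; rewrite big_nil I_zero.
under eq_fun do rewrite big_cons; rewrite big_cons -IH.
rewrite I_add//.
by apply: continuous_big => // x; exact: add_continuous.
Qed.

(** A concave cone of slope [k], with its vertex rounded at scale [mu] so that its Laplacian is at
    least - n k / mu. *)
Definition barrier (c0 k mu : R) (p0 p : E) : R := c0 - k * Num.sqrt (sqn (p - p0) + mu ^+ 2).

Lemma gauss_le1 (s : R) (p y : E) : 0 <= s -> gauss s p y <= 1.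
Proof. by move=> s0; rewrite -expR0 ler_expR mulNr oppr_le0 mulr_ge0// sqn_ge0. Qed.

(* The step in [s] is [4 s^2 t^2] because the Gaussian integral solves
   [Laplacian A + 4 s^2 d_s A = - 2 n s A]. *)
Definition heat_difference (W : R -> E -> R) (s : R) (p : E) (t : R) : R :=
  \sum_i (W s (p + t *: e_ i) + W s (p - t *: e_ i) - 2 * W s p)
  + (W (s + 4 * s ^+ 2 * t ^+ 2) p - W s p).

Lemma gauss_heat_difference (kap s : R) (p : E) : 0 < s -> exists C t1, [/\ 0 <= C, 0 < t1 &
  forall t, 0 < t -> t <= t1 ->
  t ^+ 2 * (2 * s * (2 * s * kap - n%:R)) * (expR (kap * s) * A s p) - C * t ^+ 3 <=
  heat_difference (fun s p => expR (kap * s) * A s p) s p t].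
Proof.
move=> s0.
pose P := \sum_i `|p ord0 i|.
have Pi i : `|p ord0 i| <= P by rewrite /P (bigD1 i)//= lerDl; apply: sumr_ge0 => j _; exact: normr_ge0.
have P0 : 0 <= P by apply: sumr_ge0 => i _; exact: normr_ge0.
have ypB y i : K y -> `|(y - p) ord0 i| <= B + P.
  by move=> Ky; rewrite !mxE (le_trans (ler_normB _ _))// lerD// KB.
pose M := 2 * s * (B + P) + s + 4 * s ^+ 2 * (`|kap| + n%:R * (B + P) ^+ 2).
have M1 : 0 <= 2 * s * (B + P) by rewrite mulr_ge0 ?addr_ge0// mulr_ge0// ltW.
have M3 : 0 <= 4 * s ^+ 2 * (`|kap| + n%:R * (B + P) ^+ 2).
  by rewrite mulr_ge0 ?addr_ge0// mulr_ge0// sqr_ge0.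
have M0 : 0 <= M by rewrite /M; lra.
have [C1 C10 HC1] := expR_second_difference M M0.
have [C2 C20 HC2] := expR_first_difference M M0.
pose C := n%:R * C1 + C2.
have C0 : 0 <= C by rewrite addr_ge0// mulr_ge0.
(* For t <= 1 / (2 M + 1) one has 2 M t <= 1, the range in which the Taylor bounds hold. *)
exists (expR (kap * s) * (L * C)), (Num.min 1 (2 * M + 1)^-1); split.
- by rewrite !mulr_ge0// expR_ge0.
- by rewrite lt_min ltr01 invr_gt0; lra.
move=> t t0; rewrite le_min => /andP[t1 tM].
have tM2 : t * (2 * M) <= 1.
  by move: tM; rewrite -[leRHS]mul1r ler_pdivlMr; lra.
have tM1 : t * M <= 1 by apply: le_trans tM2; rewrite ler_wpM2l ?(ltW t0)//; lra.
pose h := 4 * s ^+ 2 * t ^+ 2.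
have cg (s' : R) (p' : E) : continuous (@gauss R n s' p') by exact: continuous_gauss.
have cG (a s' : R) (p' : E) : continuous (fun y => a * gauss s' p' y).
  move=> y; apply: (@continuousM _ _ (fun=> a) (gauss s' p')); first exact: cst_continuous.
  exact: (cg s' p' y).
have cD (F G : E -> R) : continuous F -> continuous G -> continuous (fun y => F y + G y).
  by move=> cF' cG' y; apply: continuousD; [exact: cF'|exact: cG'].
pose Fi i (y : E) := gauss s (p + t *: e_ i) y + (gauss s (p - t *: e_ i) y + (- 2) * gauss s p y).
pose F2 (y : E) := expR (kap * h) * gauss (s + h) p y + (- 1) * gauss s p y.
have cFi i : continuous (Fi i) by exact: (cD _ _ (cg _ _) (cD _ _ (cg _ _) (cG _ _ _))).
have cF2 : continuous F2 by exact: (cD _ _ (cG _ _ _) (cG _ _ _)).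
pose F (y : E) := \sum_i Fi i y + F2 y.
have csum : continuous (fun y => \sum_i Fi i y).
  by apply: continuous_big => [|i _]; [exact: add_continuous|exact: cFi].
have cF : continuous F by exact: (cD _ _ csum cF2).
have FE : heat_difference (fun s p => expR (kap * s) * A s p) s p t = expR (kap * s) * I F.
  rewrite /F I_add// I_sum// /F2 I_linear; [|exact: cG|exact: cg].
  rewrite I_scale// mulrDr mulr_sumr; congr (_ + _); last first.
    rewrite -/h (_ : expR (kap * (s + h)) = expR (kap * s) * expR (kap * h)); first by ring.
    by rewrite -expRD mulrDr.
  apply: eq_bigr => i _; rewrite /Fi I_add//; last exact: (cD _ _ (cg _ _) (cG _ _ _)).
  by rewrite I_linear//; ring.
pose lam := 2 * s * (2 * s * kap - n%:R).
have FK y : K y -> `|F y + (- (t ^+ 2 * lam)) * gauss s p y| <= C * t ^+ 3.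
  move=> Ky; pose a i := 2 * s * (y - p) ord0 i.
  pose b := 4 * s ^+ 2 * (kap - sqn (y - p)).
  have aM i : `|a i| <= M.
    have s2 : 0 <= 2 * s by rewrite mulr_ge0// ltW.
    rewrite /a normrM (ger0_norm s2).
    have : 2 * s * `|(y - p) ord0 i| <= 2 * s * (B + P).
      by rewrite ler_wpM2l ?ypB.
    rewrite /M; lra.
  have bM : `|b| <= M.
    have s4 : 0 <= 4 * s ^+ 2 by rewrite mulr_ge0 ?sqr_ge0.
    rewrite /b normrM (ger0_norm s4).
    have : 4 * s ^+ 2 * `|kap - sqn (y - p)| <= 4 * s ^+ 2 * (`|kap| + n%:R * (B + P) ^+ 2).
      apply: ler_wpM2l; first exact: s4.
      rewrite (le_trans (ler_normB _ _))// lerD2l.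
      by rewrite ger0_norm ?sqn_ge0// sqn_le// => i; exact: ypB.
    rewrite /M; lra.
  have sM : `|- s| <= M by rewrite normrN gtr0_norm// /M; lra.
  pose D i := expR (t * a i + t ^+ 2 * (- s)) + expR (- (t * a i) + t ^+ 2 * (- s)) - 2.
  have FiE i : Fi i y = gauss s p y * D i.
    rewrite /Fi /D [RHS]mulrBr [in RHS]mulrDr -!expRD /gauss.
    rewrite !opprD !addrA opprK.
    have -> : y - p - t *: e_ i = (y - p) + (- t) *: e_ i by rewrite scaleNr.
    rewrite !sqnD_delta /a; congr (_ + _); last by ring.
    by congr (expR _ + expR _); ring.
  have F2E : F2 y = gauss s p y * (expR (t ^+ 2 * b) - 1).
    rewrite /F2 mulrBr mulr1 mulN1r -expRD /gauss -expRD; congr (expR _ - _).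
    by rewrite /b /h; ring.
  have E1 : F y + - (t ^+ 2 * lam) * gauss s p y = gauss s p y *
     (\sum_i (D i - t ^+ 2 * (a i ^+ 2 + 2 * (- s))) + (expR (t ^+ 2 * b) - 1 - t ^+ 2 * b)).
    rewrite /F F2E (eq_bigr (fun i => gauss s p y * D i))// -mulr_sumr.
    rewrite (sumrB _ _ (fun i => D i) (fun i => t ^+ 2 * (a i ^+ 2 + 2 * - s))).
    have -> : \sum_i t ^+ 2 * (a i ^+ 2 + 2 * - s) = t ^+ 2 * (4 * s ^+ 2 * sqn (y - p) - 2 * s * n%:R).
      rewrite -mulr_sumr big_split/= sumr_const card_ord mulr_natr; congr (_ * (_ + _)).
        by rewrite /sqn mulr_sumr; apply: eq_bigr => i _; rewrite /a; ring.
      by rewrite mulrN mulNrn.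
    by rewrite /lam /b; ring.
  rewrite E1.
  rewrite normrM ger0_norm ?expR_ge0// -[leRHS]mul1r ler_pM ?expR_ge0 ?gauss_le1 ?(ltW s0)//.
  rewrite (le_trans (ler_normD _ _))// /C [leRHS]mulrDl lerD//; last exact: HC2 (ltW t0) t1 tM1 bM.
  apply: (le_trans (ler_norm_sum _ _ _)).
  apply: (@le_trans _ _ (\sum_(i < n) C1 * t ^+ 3)); last first.
    by rewrite sumr_const card_ord -[leRHS]mulrA [leRHS]mulr_natl.
  by apply: ler_sum => i _; exact: HC1 (ltW t0) t1 tM2 (aM i) sM.
have := @I_bound (fun y => F y + (- (t ^+ 2 * lam)) * gauss s p y) _ _ _ FK.
rewrite I_linear// => H.
have {}H : `|I F + - (t ^+ 2 * lam) * I (gauss s p)| <= L * (C * t ^+ 3).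
  apply: H; last by rewrite mulr_ge0// exprn_ge0// ltW.
  exact: (cD _ _ cF (cG _ _ _)).
rewrite FE; move: H; rewrite ler_norml => /andP[H _].
have e0 : 0 <= expR (kap * s) by exact: expR_ge0.
have := ler_wpM2l e0 H; rewrite -/lam; lra.
Qed.

(** The hypothesis on [k] is the supersolution condition for exp(- s Psi): k^2 bounds |grad Psi|^2,
    and n k / (mu s) bounds - Laplacian Psi / s. *)
Lemma barrier_heat_difference (C c0 k mu s : R) (p0 p : E) : 0 <= C -> 0 <= k -> 0 < mu -> 0 < s ->
  k ^+ 2 + n%:R * k / (mu * s) <= 4 * barrier c0 k mu p0 p ->
  exists C' t1, [/\ 0 <= C', 0 < t1 & forall t, 0 < t -> t <= t1 ->
  heat_difference (fun s p => C * expR (- s * barrier c0 k mu p0 p)) s p t <= C' * t ^+ 3].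
Proof.
move=> C0 k0 mu0 s0; set psi := barrier c0 k mu p0 p => kpsi.
pose S := sqn (p - p0) + mu ^+ 2.
pose q := Num.sqrt S.
have S0 : 0 < S by rewrite /S ltr_wpDl ?sqn_ge0// exprn_gt0.
have qS : q ^+ 2 = S by rewrite sqr_sqrtr// ltW.
have q0 : 0 < q by rewrite sqrtr_gt0.
have muq : mu <= q.
  by rewrite -[leLHS](ger0_norm (ltW mu0)) -sqrtr_sqr ler_wsqrtr// /S lerDr sqn_ge0.
pose a i := s * k * (p - p0) ord0 i / q.
pose b := s * k / (2 * q).
pose P := \sum_i `|a i|.
have Pi i : `|a i| <= P by rewrite /P (bigD1 i)//= lerDl; apply: sumr_ge0 => j _; exact: normr_ge0.
have P0 : 0 <= P by apply: sumr_ge0 => i _; exact: normr_ge0.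
pose M := P + `|b| + `|4 * s ^+ 2 * psi|.
have M0 : 0 <= M by rewrite /M !addr_ge0.
have [C1 C10 HC1] := expR_second_difference M M0.
have [C2 C20 HC2] := expR_first_difference M M0.
pose V := C * expR (- s * psi).
have V0 : 0 <= V by rewrite mulr_ge0 ?expR_ge0.
exists (V * (n%:R * C1 + C2)), (Num.min 1 (2 * M + 1)^-1); split.
- by rewrite mulr_ge0// addr_ge0// mulr_ge0.
- by rewrite lt_min ltr01 invr_gt0; lra.
move=> t t0; rewrite le_min => /andP[t1 tM].
have tM2 : t * (2 * M) <= 1.
  by move: tM; rewrite -[leRHS]mul1r ler_pdivlMr; lra.
have tM1 : t * M <= 1 by apply: le_trans tM2; rewrite ler_wpM2l ?(ltW t0)//; lra.
have aM i : `|a i| <= M by rewrite (le_trans (Pi i))// /M -addrA lerDl addr_ge0.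
have bM : `|b| <= M by rewrite /M addrAC lerDr addr_ge0.
have psiM : `|- (4 * s ^+ 2 * psi)| <= M by rewrite normrN /M lerDr addr_ge0.
(* Concavity of the square root: its tangent line at [S] dominates it. *)
have step r i : - s * barrier c0 k mu p0 (p + r *: e_ i) <=
    - s * psi + (r * a i + r ^+ 2 * b).
  rewrite /psi /barrier -/S -/q.
  have -> : p + r *: e_ i - p0 = (p - p0) + r *: e_ i by rewrite addrAC.
  rewrite sqnD_delta; set x := (p - p0) ord0 i.
  have -> : sqn (p - p0) + 2 * r * x + r ^+ 2 + mu ^+ 2 = S + (2 * r * x + r ^+ 2).
    by rewrite /S; ring.
  set y := 2 * r * x + r ^+ 2.
  have Sy : 0 <= S + y.
    have -> : S + y = sqn (p - p0 + r *: e_ i) + mu ^+ 2 by rewrite sqnD_delta /S /y -/x; ring.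
    by rewrite addr_ge0 ?sqn_ge0 ?sqr_ge0.
  have qy : 0 <= q + y / (2 * q).
    rewrite -(pmulr_rge0 _ q0) mulrDr -expr2 qS.
    have -> : q * (y / (2 * q)) = y / 2 by field; rewrite gt_eqF.
    by lra.
  have sq : Num.sqrt (S + y) <= q + y / (2 * q).
    rewrite -[leRHS](ger0_norm qy) -sqrtr_sqr ler_wsqrtr//.
    have -> : (q + y / (2 * q)) ^+ 2 = q ^+ 2 + y + (y / (2 * q)) ^+ 2.
      by field; rewrite gt_eqF.
    by rewrite qS lerDl sqr_ge0.
  have sk : 0 <= s * k by rewrite mulr_ge0// ltW.
  have := ler_wpM2l sk sq.
  have -> : s * k * (q + y / (2 * q)) = s * k * q + (r * a i + r ^+ 2 * b).
    by rewrite /a /b /y -/x; field; rewrite gt_eqF.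
  by lra.
have part1 i : C * expR (- s * barrier c0 k mu p0 (p + t *: e_ i)) +
    C * expR (- s * barrier c0 k mu p0 (p - t *: e_ i)) - 2 * (C * expR (- s * psi)) <=
    V * (t ^+ 2 * (a i ^+ 2 + 2 * b) + C1 * t ^+ 3).
  have e1 : expR (- s * barrier c0 k mu p0 (p + t *: e_ i)) <=
      expR (- s * psi) * expR (t * a i + t ^+ 2 * b).
    by rewrite -expRD ler_expR.
  have e2 : expR (- s * barrier c0 k mu p0 (p - t *: e_ i)) <=
      expR (- s * psi) * expR (- (t * a i) + t ^+ 2 * b).
    by rewrite -expRD ler_expR; have := step (- t) i; rewrite sqrrN (mulNr t) scaleNr.
  have e3 := HC1 t (a i) b (ltW t0) t1 tM2 (aM i) bM.
  have {}e3 : expR (t * a i + t ^+ 2 * b) + expR (- (t * a i) + t ^+ 2 * b) - 2 <=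
      t ^+ 2 * (a i ^+ 2 + 2 * b) + C1 * t ^+ 3.
    by move: e3; rewrite ler_norml => /andP[_]; lra.
  have {}e3 := ler_wpM2l V0 e3.
  have := ler_wpM2l C0 e1; have := ler_wpM2l C0 e2; move: e3; rewrite /V; lra.
have part2 : C * expR (- (s + 4 * s ^+ 2 * t ^+ 2) * psi) - C * expR (- s * psi) <=
    V * (t ^+ 2 * (- (4 * s ^+ 2 * psi)) + C2 * t ^+ 3).
  have e := HC2 t _ (ltW t0) t1 tM1 psiM.
  have {}e : expR (t ^+ 2 * - (4 * s ^+ 2 * psi)) - 1 <=
      t ^+ 2 * (- (4 * s ^+ 2 * psi)) + C2 * t ^+ 3.
    by move: e; rewrite ler_norml => /andP[_]; lra.
  have {}e := ler_wpM2l V0 e; apply: le_trans e.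
  have -> : expR (- (s + 4 * s ^+ 2 * t ^+ 2) * psi) =
      expR (- s * psi) * expR (t ^+ 2 * - (4 * s ^+ 2 * psi)).
    by rewrite -expRD; congr expR; ring.
  by rewrite /V; lra.
have part3 : \sum_i (a i ^+ 2 + 2 * b) - 4 * s ^+ 2 * psi <= 0.
  have suma : \sum_i a i ^+ 2 <= s ^+ 2 * k ^+ 2.
    have -> : \sum_i a i ^+ 2 = (s * k / q) ^+ 2 * sqn (p - p0).
      by rewrite /sqn mulr_sumr; apply: eq_bigr => i _; rewrite /a; ring.
    have -> : (s * k / q) ^+ 2 * sqn (p - p0) = s ^+ 2 * k ^+ 2 * (sqn (p - p0) / q ^+ 2).
      by field; rewrite gt_eqF.
    apply: ler_piMr; first by rewrite mulr_ge0 ?sqr_ge0.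
    by rewrite qS ler_pdivrMr// mul1r /S lerDl sqr_ge0.
  have sumb : \sum_(i < n) 2 * b <= s ^+ 2 * (n%:R * k / (mu * s)).
    rewrite sumr_const card_ord -[leLHS]mulr_natl.
    have -> : n%:R * (2 * b) = n%:R * k * s * q^-1 by rewrite /b; field; rewrite gt_eqF.
    have -> : s ^+ 2 * (n%:R * k / (mu * s)) = n%:R * k * s * mu^-1.
      by field; rewrite !gt_eqF.
    by rewrite ler_wpM2l ?mulr_ge0 ?(ltW s0)// lef_pV2 ?posrE.
  rewrite big_split/=; have := ler_wpM2l (sqr_ge0 s) kpsi; lra.
rewrite /heat_difference -/psi.
apply: (le_trans (lerD (ler_sum _ (fun i _ => part1 i)) part2)).
rewrite -mulr_sumr -mulrDr -[leRHS]mulrA ler_wpM2l// big_split/= -mulr_sumr sumr_const card_ord.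
rewrite -[C1 * _ *+ n]mulr_natl; have := ler_wpM2l (sqr_ge0 t) part3; lra.
Qed.

End heat_inequality.

Section maximum_principle.
Context {R : realType} {n : nat}.
Local Notation E := 'rV[R]_n.
Variables (I : (E -> R) -> R) (L : R) (K : set E) (B : R).
Hypothesis L0 : 0 <= L.
Hypothesis I_linear : forall (F G : E -> R) a, continuous F -> continuous G ->
  I (fun x => F x + a * G x) = I F + a * I G.
Hypothesis I_bound : forall (G : E -> R) M, continuous G -> 0 <= M ->
  (forall y, K y -> `|G y| <= M) -> `|I G| <= L * M.
Hypothesis KB : forall y i, K y -> `|y ord0 i| <= B.
Hypothesis B0 : 0 <= B.

Local Notation A := (fun (s : R) (p : E) => I (gauss s p)).
Local Notation e_ := (delta_mx ord0).

(** The absolute value keeps the parameter nonnegative, where exp(-x) is 1-Lipschitz; it is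
    invisible for s >= s0 > 0. [D] bounds the change of the exponent over [K] and vanishes at
    [z0]. *)
Lemma continuous_gauss_integral : continuous (fun z : R * E => I (gauss `|z.1| z.2)).
Proof.
move=> z0; apply/cvgrPdist_lt => e e0.
pose D (z : R * E) := `| `|z.1| - `|z0.1| | * (n%:R * B ^+ 2) +
  2 * (\sum_i B * `| `|z.1| * z.2 ord0 i - `|z0.1| * z0.2 ord0 i |) +
  `| `|z.1| * sqn z.2 - `|z0.1| * sqn z0.2 |.
have D_ge0 z : 0 <= D z.
  by rewrite !addr_ge0// !mulr_ge0 ?sqr_ge0 ?sumr_ge0// => i _; rewrite mulr_ge0.
have bound z : `|I (gauss `|z0.1| z0.2) - I (gauss `|z.1| z.2)| <= L * D z.
  have -> : I (gauss `|z0.1| z0.2) - I (gauss `|z.1| z.2) =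
      I (fun y => gauss `|z0.1| z0.2 y + (-1) * gauss `|z.1| z.2 y).
    by rewrite I_linear ?mulN1r//; exact: continuous_gauss.
  apply: I_bound => //.
    move=> y; apply: (@continuousD _ _ _ (gauss `|z0.1| z0.2) (fun y => (-1) * gauss `|z.1| z.2 y)).
      exact: continuous_gauss.
    apply: (@continuousM _ _ (fun=> -1) (gauss `|z.1| z.2)); first exact: cst_continuous.
    exact: continuous_gauss.
  move=> y Ky; rewrite mulN1r /gauss !mulNr.
  apply: (le_trans (expR_dist_le _ _ _ _)); rewrite ?mulr_ge0 ?sqn_ge0//.
  have -> : `|z0.1| * sqn (y - z0.2) - `|z.1| * sqn (y - z.2) =
      (`|z0.1| - `|z.1|) * sqn y + 2 * (\sum_i y ord0 i * (`|z.1| * z.2 ord0 i - `|z0.1| * z0.2 ord0 i))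
      - (`|z.1| * sqn z.2 - `|z0.1| * sqn z0.2).
    have -> : \sum_i y ord0 i * (`|z.1| * z.2 ord0 i - `|z0.1| * z0.2 ord0 i) =
        `|z.1| * dot y z.2 - `|z0.1| * dot y z0.2.
      by rewrite /dot !mulr_sumr -sumrB; apply: eq_bigr => i _; ring.
    by rewrite !sqnB; ring.
  rewrite (le_trans (ler_normB _ _))// /D lerD// (le_trans (ler_normD _ _))// lerD//.
    rewrite normrM distrC ler_wpM2l// ger0_norm ?sqn_ge0//.
    by apply: sqn_le => i; exact: KB.
  rewrite normrM ger0_norm// ler_wpM2l// (le_trans (ler_norm_sum _ _ _))//.
  by apply: ler_sum => i _; rewrite normrM ler_wpM2r// KB.
have c1 : continuous (fun z : R * E => `|z.1|).
  move=> z; apply: (@continuous_comp _ _ _ (fun z : R * E => z.1) Num.norm); first exact: cvg_fst.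
  exact: (@norm_continuous _ R^o).
have cM (F G : R * E -> R) : continuous F -> continuous G -> continuous (fun z => F z * G z).
  by move=> cF cG z; apply: continuousM; [exact: cF|exact: cG].
have cD (F G : R * E -> R) : continuous F -> continuous G -> continuous (fun z => F z + G z).
  by move=> cF cG z; apply: continuousD; [exact: cF|exact: cG].
have cdist (F : R * E -> R) c : continuous F -> continuous (fun z => `|F z - c|).
  move=> cF z; apply: (@continuous_comp _ _ _ (fun z => F z - c) Num.norm).
    by apply: continuousB; [exact: cF|exact: cst_continuous].
  exact: (@norm_continuous _ R^o).
have ccst c : continuous (fun _ : R * E => c : R) by exact: cst_continuous.
have c2 i : continuous (fun z : R * E => `|z.1| * z.2 ord0 i).
  apply: (cM _ _) => // z.
  apply: (@continuous_comp _ _ _ (fun z : R * E => z.2) (fun x : E => x ord0 i)); first exact: cvg_snd.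
  exact: coord_continuous.
have c3 : continuous (fun z : R * E => `|z.1| * sqn z.2).
  apply: (cM _ _) => // z.
  apply: (@continuous_comp _ _ _ (fun z : R * E => z.2) sqn); first exact: cvg_snd.
  exact: continuous_sqn.
have cLD : continuous (fun z => L * D z).
  apply: (cM _ _ (ccst L)); apply: (cD _ _); last exact: (cdist _ _ c3).
  apply: (cD _ _); first exact: (cM _ _ (cdist _ _ c1) (ccst _)).
  apply: (cM _ _ (ccst 2)); apply: continuous_big => [|i _]; first exact: add_continuous.
  exact: (cM _ _ (ccst B) (cdist _ _ (c2 i))).
have LD0 : L * D z0 = 0.
  by rewrite /D !subrr !normr0 mul0r big1 ?mulr0 ?addr0 ?mulr0// => i _; rewrite subrr normr0 mulr0.
have /cvgrPdist_lt /(_ e e0) := cLD z0; rewrite LD0.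
apply: filterS => z; rewrite sub0r normrN ger0_norm ?mulr_ge0// => /(le_lt_trans (bound z)).
by [].
Qed.

Lemma continuous_barrier (c0 k mu : R) (p0 : E) : continuous (barrier c0 k mu p0).
Proof.
have csq : continuous (fun p : E => Num.sqrt (sqn (p - p0) + mu ^+ 2)).
  move=> p; apply: (@continuous_comp _ _ _ (fun p : E => sqn (p - p0) + mu ^+ 2) Num.sqrt).
    apply: (@continuousD _ _ _ (fun p : E => sqn (p - p0)) (fun _ : E => mu ^+ 2)).
      exact: continuous_sqn_sub.
    exact: cst_continuous.
  exact: sqrt_continuous.
move=> p; apply: (@continuousB _ R^o _ (fun _ : E => c0)
  (fun p : E => k * Num.sqrt (sqn (p - p0) + mu ^+ 2))); first exact: cst_continuous.
apply: (@continuousM _ _ (fun _ : E => k) (fun p : E => Num.sqrt (sqn (p - p0) + mu ^+ 2))).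
  exact: cst_continuous.
exact: csq.
Qed.

(** [heat_difference] steps forward in s, so data are needed at the upper end of the s-range, where
    the decay supplies them, and none at [s0]. At a maximum of U - V in the third case, the
    difference of U is at most that of V, which is O(t^3), whereas the positive coefficient makes it
    at least a positive multiple of t^2. *)
Lemma maximum_principle (Om : set E) (kap c0 k mu C s0 C1 g : R) (p0 : E) :
  compact Om -> 0 < s0 -> 0 < kap -> n%:R < 2 * s0 * kap -> 0 <= k -> 0 < mu -> 0 <= C ->
  0 < g -> 0 <= C1 ->
  (forall p s, Om p -> s0 <= s -> A s p <= C1 * expR (- s * (kap + g))) ->
  (forall p, Om p -> [\/ forall s, s0 <= s -> A s p <= 0,
     forall s, s0 <= s -> expR (kap * s) * A s p <= C * expR (- s * barrier c0 k mu p0 p) |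
     k ^+ 2 + n%:R * k / (mu * s0) <= 4 * barrier c0 k mu p0 p /\
     exists2 d, 0 < d & forall i t, `|t| <= d -> Om (p + t *: e_ i)]) ->
  forall p s, Om p -> s0 <= s ->
    expR (kap * s) * A s p <= C * expR (- s * barrier c0 k mu p0 p).
Proof.
move=> cOm s00 kap0 nkap k0 mu0 C0 g0 C10 decay cases pa sa Opa sa0.
rewrite leNgt; apply/negP => gap.
pose U (s : R) p := expR (kap * s) * A s p.
pose V (s : R) p := C * expR (- s * barrier c0 k mu p0 p).
pose eps := (U sa pa - V sa pa) / 2.
have eps0 : 0 < eps by rewrite divr_gt0// subr_gt0.
have V0 s p : 0 <= V s p by rewrite mulr_ge0 ?expR_ge0.
(* Beyond [s1] the decay keeps U under [eps], half of the assumed violation, so the maximum may be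
   sought on a compact set and is not attained at [s1]. *)
have [s1 sa1 s1eps] : exists2 s1, sa <= s1 & C1 * expR (- s1 * g) < eps.
  exists (Num.max sa (C1 / (g * eps))); first by rewrite le_max lexx.
  set s1 := Num.max _ _; have : C1 / (g * eps) <= s1 by rewrite le_max lexx orbT.
  have ge : 0 < g * eps by exact: mulr_gt0.
  rewrite (ler_pdivrMr _ _ ge) => s1C.
  rewrite mulNr expRN ltr_pdivrMr ?expR_gt0//.
  have := ler_wpM2l (ltW eps0) (expR_ge1Dx (s1 * g)); lra.
pose W (z : R * E) := U `|z.1| z.2 - V `|z.1| z.2.
have cM (F G : R * E -> R) : continuous F -> continuous G -> continuous (fun z => F z * G z).
  by move=> cF cG z; apply: continuousM; [exact: cF|exact: cG].
have cB (F G : R * E -> R) : continuous F -> continuous G -> continuous (fun z => F z - G z).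
  by move=> cF cG z; apply: continuousB; [exact: cF|exact: cG].
have cexp (F : R * E -> R) : continuous F -> continuous (fun z => expR (F z)).
  by move=> cF z; apply: (@continuous_comp _ _ _ F expR); [exact: cF|exact: continuous_expR].
have ccst c : continuous (fun _ : R * E => c : R) by exact: cst_continuous.
have c1 : continuous (fun z : R * E => `|z.1|).
  move=> z; apply: (@continuous_comp _ _ _ (fun z : R * E => z.1) Num.norm); first exact: cvg_fst.
  exact: (@norm_continuous _ R^o).
have cN : continuous (fun z : R * E => - `|z.1|).
  move=> z; apply: (@continuous_comp _ _ _ (fun z : R * E => `|z.1|) -%R); first exact: c1.
  exact: opp_continuous.
have cb : continuous (fun z : R * E => barrier c0 k mu p0 z.2).
  move=> z; apply: (@continuous_comp _ _ _ (fun z : R * E => z.2) (barrier c0 k mu p0)).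
    exact: cvg_snd.
  exact: continuous_barrier.
have cW : continuous W.
  apply: cB; last exact: (cM _ _ (ccst _) (cexp _ (cM _ _ cN cb))).
  apply: (cM _ _ (cexp _ (cM _ _ (ccst _) c1))).
  exact: continuous_gauss_integral.
have [[s p]] : exists2 c, c \in `[s0, s1]%classic `*` Om &
    forall z, z \in `[s0, s1]%classic `*` Om -> W z <= W c.
  apply: compact_EVT_max.
  - by exists (sa, pa); split => //=; rewrite in_itv/= sa0.
  - by apply: compact_setX => //; exact: segment_compact.
  - exact: continuous_subspaceT.
rewrite inE => -[/= + Op] Wmax; rewrite in_itv/= => /andP[s0s ss1].
have s_gt0 : 0 < s by rewrite (lt_le_trans s00).
have Wle s' p' : s0 <= s' -> s' <= s1 -> Om p' -> U s' p' - V s' p' <= U s p - V s p.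
  move=> h1 h2 Op'; have := Wmax (s', p'); rewrite /W/= !ger0_norm ?(ltW s_gt0)//; last first.
    by rewrite (le_trans (ltW s00)).
  by apply; rewrite inE; split => //=; rewrite in_itv/= h1.
have Wpos : eps < U s p - V s p.
  apply: lt_le_trans (Wle sa pa sa0 sa1 Opa).
  have -> : U sa pa - V sa pa = 2 * eps by rewrite /eps; field.
  by lra.
have ss1_lt : s < s1.
  rewrite lt_neqAle ss1 andbT; apply/eqP => ss.
  have : U s p <= C1 * expR (- s * g).
    rewrite /U (le_trans (ler_wpM2l (expR_ge0 _) (decay p s Op s0s)))//.
    rewrite mulrCA ler_wpM2l// -expRD ler_expR; lra.
  rewrite {2}ss => H; have := V0 s p; lra.
have [Ale|Ale|[kpsi [d d0 dOm]]] := cases p Op.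
- have := Ale s s0s; have := V0 s p; rewrite /U in Wpos *.
  have : expR (kap * s) * A s p <= 0 by rewrite pmulr_rle0 ?expR_gt0 ?Ale.
  lra.
- have := Ale s s0s; rewrite -/(U s p) -/(V s p); lra.
have kpsi' : k ^+ 2 + n%:R * k / (mu * s) <= 4 * barrier c0 k mu p0 p.
  apply: le_trans kpsi; rewrite lerD2l ler_wpM2l ?mulr_ge0//.
  by rewrite lef_pV2 ?posrE ?mulr_gt0// ler_wpM2l// ltW.
have [D1 [t1 [D10 t10 H1]]] := gauss_heat_difference I L K B L0 I_linear I_bound KB B0 kap s p s_gt0.
have [D2 [t2 [D20 t20 H2]]] := barrier_heat_difference C c0 k mu s p0 p C0 k0 mu0 s_gt0 kpsi'.
pose lam := 2 * s * (2 * s * kap - n%:R).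
have lam0 : 0 < lam.
  rewrite mulr_gt0 ?mulr_gt0// subr_gt0 (lt_le_trans nkap)// ler_wpM2r ?(ltW kap0)//.
  by rewrite ler_wpM2l.
pose hs := (s1 - s) / (4 * s ^+ 2).
have hs0 : 0 < hs by rewrite divr_gt0 ?subr_gt0// mulr_gt0// exprn_gt0.
pose te := lam * eps / (2 * (D1 + D2 + 1)).
have D0 : 0 < 2 * (D1 + D2 + 1) by lra.
have te0 : 0 < te by rewrite divr_gt0// mulr_gt0.
(* [t1] and [t2] validate the two expansions, [d] keeps the space steps in [Om], [hs] together with
   t <= 1 keeps the s-step below [s1], and [te] makes the cubic errors smaller than t^2 lam eps. *)
pose t := Num.min (Num.min (Num.min t1 t2) (Num.min 1 d)) (Num.min hs te).
have t0 : 0 < t by rewrite !lt_min t10 t20 ltr01 d0 hs0 te0.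
have : t <= t by [].
rewrite {2}/t !le_min => /andP[/andP[/andP[tt1 tt2] /andP[tt3 td]] /andP[ths tte]].
have sh : s + 4 * s ^+ 2 * t ^+ 2 <= s1.
  have : t ^+ 2 <= t by rewrite expr2 ler_piMl// ltW.
  have s4 : 0 < 4 * s ^+ 2 by rewrite mulr_gt0// exprn_gt0.
  move: ths; rewrite /hs ler_pdivlMr// => ths tt.
  have := ler_wpM2l (ltW s4) tt; lra.
have max_step : heat_difference U s p t <= heat_difference V s p t.
  rewrite /heat_difference; apply: lerD.
    apply: ler_sum => i _.
    have := Wle s _ s0s ss1 (dOm i t _); have := Wle s _ s0s ss1 (dOm i (- t) _).
    rewrite normrN ger0_norm ?(ltW t0)// scaleNr => /(_ td) h1 /(_ td) h2.
    move: h1 h2; lra.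
  have : s0 <= s + 4 * s ^+ 2 * t ^+ 2.
    by rewrite (le_trans s0s)// lerDl mulr_ge0 ?sqr_ge0// mulr_ge0 ?sqr_ge0.
  by move=> /Wle /(_ sh Op); lra.
have := H1 t t0 tt1; rewrite -/lam -/(U s p) => {}H1.
have {}H2 := H2 t t0 tt2.
have U_eps : eps <= U s p by have := V0 s p; lra.
have : t ^+ 2 * lam * eps <= (D1 + D2) * t ^+ 3.
  have := ler_wpM2l (mulr_ge0 (sqr_ge0 t) (ltW lam0)) U_eps.
  move: max_step H1 H2; rewrite /U /V; lra.
have -> : (D1 + D2) * t ^+ 3 = t ^+ 2 * ((D1 + D2) * t) by ring.
rewrite -mulrA ler_pM2l ?exprn_gt0// leNgt => /negP; apply.
move: tte; rewrite /te ler_pdivlMr//.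
have : 0 <= (D1 + D2) * t by rewrite mulr_ge0 ?addr_ge0// ltW.
lra.
Qed.

End maximum_principle.

(** * Localization *)

Section exponential_tail.
Context {R : realType}.
Implicit Types x M : R.

Lemma expR_tail_le (N : nat) x M : 0 <= x -> x <= M ->
  expR x - \sum_(0 <= k < N) exp_coeff x k <= expR M - \sum_(0 <= k < N) exp_coeff M k.
Proof.
move=> x0 xM; have L (y : R) : series (exp_coeff y) m - \sum_(0 <= k < N) exp_coeff y k @[m --> \oo] -->
    expR y - \sum_(0 <= k < N) exp_coeff y k.
  by apply: cvgB; [exact: is_cvg_series_exp_coeff|exact: cvg_cst].
apply: (ler_cvg_to (L x) (L M)); near=> m.
have Nm : (N <= m)%N by near: m; exact: nbhs_infty_ge.
rewrite /series/= !(big_cat_nat (leq0n N) Nm)/= ![_ + \sum_(N <= k < m) _]addrC !addrK.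
apply: ler_sum => k _; rewrite !exp_coeffE ler_wpM2l ?invr_ge0//.
by rewrite lerXn2r ?nnegrE// (le_trans x0).
Unshelve. all: by end_near. Qed.

Lemma expR_tail_cvg0 M : expR M - \sum_(0 <= k < N) exp_coeff M k @[N --> \oo] --> 0.
Proof.
have c : series (exp_coeff M) N @[N --> \oo] --> expR M by exact: is_cvg_series_exp_coeff.
by rewrite -[X in _ --> X](subrr (expR M)); apply: cvgB; [exact: cvg_cst|exact: c].
Qed.

Lemma expR_partial_le (N : nat) x : 0 <= x -> \sum_(0 <= k < N) exp_coeff x k <= expR x.
Proof.
move=> x0; have := expR_taylor N x; rewrite (ger0_norm x0).
by move=> /(le_trans (normr_ge0 _)); rewrite subr_ge0.
Qed.

End exponential_tail.

Section localization.
Context {R : realType} {n : nat}.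
Local Notation E := 'rV[R]_n.
Variables (I : (E -> R) -> R) (L : R) (K : set E).
Hypothesis I_linear : forall (F G : E -> R) a, continuous F -> continuous G ->
  I (fun x => F x + a * G x) = I F + a * I G.
Hypothesis I_bound : forall (G : E -> R) M, continuous G -> 0 <= M ->
  (forall y, K y -> `|G y| <= M) -> `|I G| <= L * M.

(* A smoothed indicator of the ball [sqn (y - p1) < T], sharp as [s] grows. *)
Definition cutoff (s T : R) (p1 y : E) : R := 1 - expR (- expR (s * (T - sqn (y - p1)))).

Lemma continuous_cutoff s T p1 : continuous (cutoff s T p1).
Proof.
have cM (F G : E -> R) : continuous F -> continuous G -> continuous (fun z => F z * G z).
  by move=> cF cG z; apply: continuousM; [exact: cF|exact: cG].
have ccst r : continuous (fun _ : E => r : R) by exact: cst_continuous.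
have cB (F G : E -> R) : continuous F -> continuous G -> continuous (fun z => F z - G z).
  by move=> cF cG z; apply: continuousB; [exact: cF|exact: cG].
have cexp (F : E -> R) : continuous F -> continuous (fun z => expR (F z)).
  by move=> cF z; apply: (@continuous_comp _ _ _ F expR); [exact: cF|exact: continuous_expR].
apply: (cB _ _ (ccst 1)); apply: (cexp (fun y : E => - expR (s * (T - sqn (y - p1))))) => y.
apply: (@continuous_comp _ _ _ (fun y : E => expR (s * (T - sqn (y - p1)))) -%R); last exact: opp_continuous.
apply: (cexp (fun y : E => s * (T - sqn (y - p1)))); apply: (cM _ _ (ccst _)).
by apply: (cB _ _ (ccst _)); exact: continuous_sqn_sub.
Qed.

Lemma cutoff_ge0 s T p1 y : 0 <= cutoff s T p1 y.
Proof. by rewrite subr_ge0 -expR0 ler_expR oppr_le0 expR_ge0. Qed.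

Lemma cutoff_le1 s T p1 y : cutoff s T p1 y <= 1.
Proof. by rewrite /cutoff lerBlDr lerDl expR_ge0. Qed.

Lemma cutoff_ge_half s T p1 y : 0 <= s -> sqn (y - p1) <= T -> 2^-1 <= cutoff s T p1 y.
Proof.
move=> s0 yT; rewrite /cutoff lerBrDr -lerBrDl.
have -> : 1 - 2^-1 = 2^-1 :> R by lra.
have e1 : 1 <= expR (s * (T - sqn (y - p1))).
  by rewrite -expR0 ler_expR mulr_ge0// subr_ge0.
rewrite expRN lef_pV2 ?posrE ?expR_gt0//.
have := expR_ge1Dx (expR (s * (T - sqn (y - p1)))); lra.
Qed.

(** Expanding 1 - exp(-X) turns the cutoff into a combination of Gaussians centred at [p1] with
    parameters k s, k >= 1. *)
Lemma cutoff_taylor s T p1 N y :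
  `|cutoff s T p1 y - \sum_(k < N) (- (-1) ^+ k.+1 / k.+1`!%:R * expR (k.+1%:R * (s * T)))
     * gauss (k.+1%:R * s) p1 y| <=
  expR (expR (s * (T - sqn (y - p1)))) - \sum_(0 <= k < N.+1) exp_coeff (expR (s * (T - sqn (y - p1)))) k.
Proof.
set X := expR (s * (T - sqn (y - p1))).
have X0 : 0 <= X by exact: expR_ge0.
have := expR_taylor N.+1 (- X); rewrite normrN (ger0_norm X0); apply: le_trans.
rewrite le_eqVlt; apply/orP; left; apply/eqP.
rewrite -[RHS]normrN; congr `|_|.
rewrite /cutoff -/X big_nat_recl// big_mkord exp_coeffE/= fact0 invr1 mul1r expr0.
have -> : \sum_(i < N) (i.+1)`!%:R^-1 * (- X) ^+ i.+1 =
   - \sum_(k < N) (- (-1) ^+ k.+1 / k.+1`!%:R * expR (k.+1%:R * (s * T))) * gauss (k.+1%:R * s) p1 y.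
  rewrite -sumrN; apply: eq_bigr => k _.
  rewrite -mulrA /gauss -expRD.
  have -> : k.+1%:R * (s * T) + - (k.+1%:R * s) * sqn (y - p1) = k.+1%:R * (s * (T - sqn (y - p1))).
    by ring.
  rewrite expRM_natl -/X (exprNn X); move: ((-1) ^+ k.+1) (X ^+ k.+1) (_^-1) => a b c.
  by ring.
by ring.
Qed.

(** In the series of the cutoff the k-th coefficient has size exp(k s T) / k!, and the decay brings
    exp(- k s Ts). The sum is at most C (exp x - 1) with x = exp(- s (Ts - T)), which is small for
    large s. *)
Lemma localization (T Ts c C s2 : R) (p1 y1 : E) : T < Ts -> 0 <= C ->
  (forall s, s2 <= s -> `|I (fun y => gauss s p1 y * gauss c y1 y)| <= C * expR (- s * Ts)) ->
  0 <= c ->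
  forall e, 0 < e -> exists2 s, 0 <= s &
    `|I (fun y => cutoff s T p1 y * gauss c y1 y)| <= e.
Proof.
move=> TTs C0 decay c0 e e0.
pose d := Ts - T; have d0 : 0 < d by rewrite subr_gt0.
(* From exp x - 1 <= exp(1) x and x <= 1 / (1 + s d), it suffices that C exp(1) <= s d e. *)
pose s := Num.max (Num.max s2 0) (C * expR 1 / (d * e)).
have s0 : 0 <= s by rewrite !le_max lexx orbT.
have s2s : s2 <= s by rewrite !le_max lexx.
have de : 0 < d * e by exact: mulr_gt0.
have sC : C * expR 1 <= s * (d * e) by rewrite -ler_pdivrMr// /s le_max lexx orbT.
exists s => //; rewrite leNgt; apply/negP => gap.
pose J := `|I (fun y => cutoff s T p1 y * gauss c y1 y)|.
pose M := expR (s * T).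
pose x := expR (- s * d).
have x1 : `|x| <= 1.
  by rewrite ger0_norm ?expR_ge0// -expR0 ler_expR mulNr oppr_le0 mulr_ge0// ltW.
have cg s' p' : continuous (@gauss R n s' p') by exact: continuous_gauss.
have cM (F G : E -> R) : continuous F -> continuous G -> continuous (fun z => F z * G z).
  by move=> cF cG z; apply: continuousM; [exact: cF|exact: cG].
have ccst r : continuous (fun _ : E => r : R) by exact: cst_continuous.
have ccut : continuous (cutoff s T p1) by exact: continuous_cutoff.
have bound N : J <= C * (expR x - 1) + L * (expR M - \sum_(0 <= k < N.+1) exp_coeff M k).
  pose a (k : nat) : R := - (-1) ^+ k.+1 / k.+1`!%:R * expR (k.+1%:R * (s * T)).
  pose P (y : E) := \sum_(k < N) a k * (gauss (k.+1%:R * s) p1 y * gauss c y1 y).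
  have cPk (k : nat) : continuous (fun y : E => gauss (k.+1%:R * s) p1 y * gauss c y1 y) by exact: cM.
  have cP : continuous P.
    by apply: continuous_big => [|k _]; [exact: add_continuous|exact: (cM _ _ (ccst _))].
  have IP : `|I P| <= C * (expR x - 1).
    rewrite (I_sum I I_linear)//; last by move=> k; exact: (cM _ _ (ccst _)).
    apply: (le_trans (ler_norm_sum _ _ _)).
    apply: (@le_trans _ _ (\sum_(k < N) C * exp_coeff x k.+1)).
      apply: ler_sum => k _; rewrite (I_scale I I_linear)// normrM.
      have sk : s2 <= k.+1%:R * s.
        by rewrite (le_trans s2s)// ler_peMl// ler1n.
      apply: (le_trans (ler_wpM2l (normr_ge0 _) (decay _ sk))).
      rewrite /a normrM normrM normrN normrX normrN1 expr1n mul1r.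
      rewrite ger0_norm ?invr_ge0// ger0_norm ?expR_ge0//.
      rewrite le_eqVlt; apply/orP; left; apply/eqP.
      rewrite exp_coeffE/= /x -expRM_natl.
      have -> : k.+1%:R * (- s * d) = k.+1%:R * (s * T) + (- (k.+1%:R * s) * Ts).
        by rewrite /d; ring.
      by rewrite expRD; ring.
    rewrite -mulr_sumr ler_wpM2l// lerBrDl.
    have := expR_partial_le N.+1 x (expR_ge0 _).
    by rewrite big_nat_recl// big_mkord exp_coeffE/= fact0 invr1 mul1r expr0.
  have c0' : continuous (fun y => cutoff s T p1 y * gauss c y1 y) by exact: cM.
  have rem : `|I (fun y => cutoff s T p1 y * gauss c y1 y + (-1) * P y)| <=
      L * (expR M - \sum_(0 <= k < N.+1) exp_coeff M k).
    apply: I_bound.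
    - by move=> y; apply: (@continuousD _ _ _ (fun y => cutoff s T p1 y * gauss c y1 y) (fun y => (-1) * P y));
        [exact: c0'|exact: (cM _ _ (ccst (-1)) cP)].
    - by rewrite subr_ge0 expR_partial_le// expR_ge0.
    move=> y _; have -> : cutoff s T p1 y * gauss c y1 y + (-1) * P y =
        (cutoff s T p1 y - \sum_(k < N) a k * gauss (k.+1%:R * s) p1 y) * gauss c y1 y.
      rewrite [RHS]mulrBl mulr_suml mulN1r /P; congr (_ - _); apply: eq_bigr => k _.
      by rewrite mulrA.
    rewrite normrM [`|gauss _ _ _|]ger0_norm ?expR_ge0//.
    rewrite -[leRHS]mulr1 ler_pM ?expR_ge0 ?gauss_le1//.
    apply: (le_trans (cutoff_taylor s T p1 N y)); apply: expR_tail_le; first exact: expR_ge0.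
    by rewrite ler_expR ler_wpM2l// gerBl sqn_ge0.
  move: rem; rewrite I_linear// => rem.
  rewrite /J; have -> : I (fun y => cutoff s T p1 y * gauss c y1 y) =
     I P + (I (fun y => cutoff s T p1 y * gauss c y1 y) + (-1) * I P) by ring.
  by rewrite (le_trans (ler_normD _ _))// lerD.
(* With [s] fixed, the truncation error is uniform in y, because exp(s (T - |y - p1|^2)) <= [M]; it
   disappears as N grows. *)
have limbound : C * (expR x - 1) + L * (expR M - \sum_(0 <= k < N.+1) exp_coeff M k) @[N --> \oo]
    --> C * (expR x - 1) + L * 0.
  apply: cvgD; first exact: cvg_cst.
  apply: cvgM; first exact: cvg_cst.
  by have := @expR_tail_cvg0 R M; rewrite -cvg_shiftS.
have JC : J <= C * (expR x - 1).
  rewrite -[leRHS]addr0 -[X in _ + X](mulr0 L).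
  have limJ : J @[_ --> \oo] --> J by exact: cvg_cst.
  by apply: (ler_cvg_to limJ limbound); near=> N; exact: bound.
have := expR_taylor_small 1 x x1; rewrite big_nat1 exp_coeffE/= fact0 invr1 mul1r expr0 expr1.
rewrite (ger0_norm (expR_ge0 _)) => /(le_trans (ler_norm _)) ex.
have : J <= C * (expR 1 * x) by rewrite (le_trans JC)// ler_wpM2l.
have : x <= (1 + s * d)^-1.
  rewrite /x mulNr expRN lef_pV2 ?posrE ?expR_gt0 ?expR_ge1Dx//.
  by rewrite ltr_pwDl// mulr_ge0// ltW.
move=> xs Jx; move: gap; rewrite -/J ltNge => /negP; apply.
have sd : 0 < 1 + s * d by rewrite ltr_pwDl// mulr_ge0// ltW.
rewrite (le_trans Jx)// mulrA (le_trans (ler_wpM2l _ xs)) ?mulr_ge0 ?expR_ge0//.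
rewrite ler_pdivrMr//; move: sC; lra.
Unshelve. all: by end_near. Qed.

End localization.

(** * Lower bound for squared distances to a set inside a half-space *)

Section distance_estimate.
Context {R : realType} {n : nat}.
Implicit Types x y z q p v : 'rV[R]_n.

Lemma enormE x : enorm x = Num.sqrt (sqn x). Proof. by []. Qed.

Lemma sqr_enormE x : enorm x ^+ 2 = sqn x.
Proof. exact: sqr_enorm. Qed.

Lemma sqnZ (a : R) x : sqn (a *: x) = a ^+ 2 * sqn x.
Proof. by rewrite /sqn mulr_sumr; apply: eq_bigr => i _; rewrite mxE exprMn. Qed.

Lemma dotC x y : dot x y = dot y x.
Proof. by apply: eq_bigr => i _; rewrite mulrC. Qed.

Lemma dotZl (a : R) x y : dot (a *: x) y = a * dot x y.
Proof. by rewrite /dot mulr_sumr; apply: eq_bigr => i _; rewrite mxE mulrA. Qed.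

Lemma dotDl x y z : dot (x + y) z = dot x z + dot y z.
Proof. by rewrite /dot -big_split/=; apply: eq_bigr => i _; rewrite mxE mulrDl. Qed.

Lemma dot_self x : dot x x = sqn x.
Proof. by apply: eq_bigr => i _; rewrite expr2. Qed.

Lemma cauchy_schwarz x y : dot x y <= enorm x * enorm y.
Proof.
have [x0|x0] := eqVneq (enorm x) 0.
  rewrite x0 mul0r (enorm_eq0 _ _ x0) /dot big1// => i _; by rewrite mxE mul0r.
have [y0|y0] := eqVneq (enorm y) 0.
  rewrite y0 mulr0 (enorm_eq0 _ _ y0) /dot big1// => i _; by rewrite mxE mulr0.
have ab : 0 < 2 * (enorm x * enorm y).
  by rewrite mulr_gt0// mulr_gt0// lt0r ?x0 ?y0 enorm_ge0.
have := sqn_ge0 (enorm y *: x - enorm x *: y).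
rewrite sqnB !sqnZ dotZl dotC dotZl dotC -!sqr_enormE => H.
by rewrite -(ler_pM2l ab); lra.
Qed.

Lemma le_sqrt_enorm x (c : R) : 0 <= c -> sqn x <= c ^+ 2 -> enorm x <= c.
Proof.
by move=> c0 xc; rewrite -[leRHS](ger0_norm c0) -sqrtr_sqr ler_wsqrtr.
Qed.

(* [q] moves away from the half-space of direction [v] (up to the error [eta]),
   whereas every [z] lies at height at least [c1] inside it; writing
   [z = (z - (c1/|v|^2) v) + (c1/|v|^2) v] bounds [dot q z] away from [|q| |z|]. *)
Lemma dist_lower (v : 'rV[R]_n) (c1 R2 D d0 th rho : R) : 0 < c1 -> 0 < sqn v -> 0 < d0 ->
  d0 ^+ 2 = D -> 0 <= th -> th ^+ 2 = 1 - c1 ^+ 2 / sqn v / R2 -> 0 < rho -> 0 < R2 ->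
  th + rho <= 1 ->
  forall q z, dot v q <= rho * d0 * sqn v / c1 * enorm q -> c1 <= dot v z ->
    sqn z <= R2 -> D <= sqn z -> enorm q <= d0 ->
    D - 2 * (th + rho) * d0 * enorm q <= sqn (z - q).
Proof.
move=> c10 v0 d00 dD th0 thE rho0 R20 thr1 q z vq vz zR Dz qd.
have gz : 0 < c1 ^+ 2 / sqn v by rewrite divr_gt0// exprn_gt0.
set k1 := c1 / sqn v.
have k10 : 0 < k1 by rewrite divr_gt0.
have dz : d0 <= enorm z.
  by rewrite -(ger0_norm (ltW d00)) -sqrtr_sqr dD ler_wsqrtr.
have z0 : 0 <= enorm z := enorm_ge0 z.
have q0 : 0 <= enorm q := enorm_ge0 q.
have w : enorm (z - k1 *: v) <= th * enorm z.
  apply: le_sqrt_enorm; first by rewrite mulr_ge0.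
  rewrite sqnB sqnZ dotC dotZl (exprMn _ th) sqr_enormE thE.
  have -> : sqn z - 2 * (k1 * dot v z) + k1 ^+ 2 * sqn v =
     sqn z - c1 ^+ 2 / sqn v - 2 * (k1 * (dot v z - c1)).
    by rewrite /k1; field; rewrite gt_eqF.
  have h1 : 0 <= k1 * (dot v z - c1) by rewrite mulr_ge0 ?subr_ge0// ltW.
  have h2 : c1 ^+ 2 / sqn v / R2 * sqn z <= c1 ^+ 2 / sqn v.
    by rewrite -[leLHS]mulrA ger_pMr// mulrC ler_pdivrMr ?mul1r.
  lra.
have qz : dot q z <= enorm q * ((th + rho) * enorm z).
  have -> : dot q z = dot q (z - k1 *: v) + k1 * dot v q.
    rewrite -{1}[z](subrK (k1 *: v)) dotC dotDl dotZl; congr (_ + _).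
    by rewrite dotC.
  have h1 := cauchy_schwarz q (z - k1 *: v).
  have h2 := ler_wpM2l q0 w.
  have h3 : k1 * dot v q <= rho * d0 * enorm q.
    have := ler_wpM2l (ltW k10) vq; rewrite /k1.
    have -> // : c1 / sqn v * (rho * d0 * sqn v / c1 * enorm q) = rho * d0 * enorm q.
    by field; rewrite !gt_eqF.
  have h4 : rho * d0 * enorm q <= enorm q * (rho * enorm z).
    by rewrite mulrC; apply: ler_wpM2l => //; rewrite ler_wpM2l// ltW.
  lra.
rewrite sqnB dotC -(sqr_enormE z) -(sqr_enormE q) -dD.
have h : 0 <= (enorm z - d0) * (enorm z + d0 - 2 * (th + rho) * enorm q).
  rewrite mulr_ge0 ?subr_ge0//.
  have := ler_wpM2r q0 thr1; lra.
have := sqr_ge0 (enorm q).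
move: h qz; lra.
Qed.

End distance_estimate.

(** * Uniqueness *)

Section uniqueness.
Context {R : realType} {m : nat}.
Local Notation n := m.+1.
Local Notation E := 'rV[R]_n.

Lemma norm_le_sqn (x : E) : `|x| ^+ 2 <= sqn x.
Proof. by rewrite -sqr_enormE lerXn2r ?nnegrE ?enorm_ge0// norm_le_enorm. Qed.

Lemma sqn_le_norm (x : E) : sqn x <= n%:R * `|x| ^+ 2.
Proof. by apply: sqn_le => i; exact: le_coord_norm. Qed.

(** One sufficiently large [c] replaces the limit: the Gaussian near [y1] outweighs its size outside
    the ball of radius [r1], the only place where f can have the opposite sign. *)
Lemma nonvanishing_contradiction (I : (E -> R) -> R) (L T r1 : R) (f : E -> R) (p1 y1 : E) :
  0 <= L -> 0 < r1 ->
  (forall r, 0 < r -> exists2 w, 0 < w &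
    forall (G : E -> R) (a b : R), continuous G -> 0 <= a -> 0 <= b ->
      (forall y, 0 <= G y) -> (forall y, `|y - y1| <= r -> a <= G y) ->
      (forall y, f y * f y1 < 0 -> G y <= b) -> w * a <= `|I G| + L * b) ->
  (forall y, `|y - y1| <= r1 -> 0 <= f y * f y1) ->
  (forall y, `|y - y1| <= r1 -> sqn (y - p1) <= T) ->
  (forall c e, 0 <= c -> 0 < e -> exists2 s, 0 <= s &
    `|I (fun y => cutoff s T p1 y * gauss c y1 y)| <= e) -> False.
Proof.
move=> L0 r10 pos fsign nearT decay.
(* The max-norm ball of radius [r] lies in |y - y1|^2 <= r1^2 / 4 for the Euclidean norm, while
   outside that of radius [r1] this square exceeds r1^2. *)
pose r := r1 / (2 * n%:R).
have n0 : 0 < n%:R :> R by rewrite ltr0n.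
have r0 : 0 < r by rewrite divr_gt0// mulr_gt0.
have rr1 : r <= r1.
  by rewrite ler_pdivrMr ?mulr_gt0// ler_peMr ?(ltW r10)// -natrM ler1n muln_gt0.
have nr : n%:R * r ^+ 2 <= r1 ^+ 2 / 4.
  have -> : n%:R * r ^+ 2 = r1 ^+ 2 / 4 / n%:R by rewrite /r; field; rewrite gt_eqF.
  by rewrite ler_pdivrMr// ler_peMr ?ler1n// divr_ge0 ?sqr_ge0.
have [w w0 lower] := pos r r0.
have r12 : 0 < r1 ^+ 2 by rewrite exprn_gt0.
(* Chosen so that c (3/4) r1^2 = 2 (L + 1) / w. Then a / b >= (1 + 2 (L + 1) / w) / 2, hence w a >
   (L + 1) b. *)
pose c := 4 / (3 * r1 ^+ 2) * (2 * (L + 1) / w).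
have c0 : 0 <= c.
  by rewrite mulr_ge0 ?divr_ge0 ?mulr_ge0 ?(ltW w0) ?(ltW r12)//; lra.
pose a := 2^-1 * expR (- c * (r1 ^+ 2 / 4)).
pose b := expR (- c * r1 ^+ 2).
have a0 : 0 <= a by rewrite mulr_ge0 ?expR_ge0// invr_ge0.
have b0 : 0 < b by exact: expR_gt0.
have [s s0 Is] := decay c b c0 b0.
have := lower (fun y => cutoff s T p1 y * gauss c y1 y) a b.
have cG : continuous (fun y => cutoff s T p1 y * gauss c y1 y).
  by move=> y; apply: (@continuousM _ _ (cutoff s T p1) (gauss c y1));
    [exact: continuous_cutoff|exact: continuous_gauss].
move=> /(_ cG a0 (ltW b0)) H.
have {H} : w * a <= b + L * b.
  apply: (le_trans (H _ _ _)); last by rewrite lerD2r.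
  - by move=> y; rewrite mulr_ge0 ?cutoff_ge0 ?expR_ge0.
  - move=> y yr; rewrite /a ler_pM ?invr_ge0 ?expR_ge0//.
      by apply: cutoff_ge_half => //; apply: nearT; rewrite (le_trans yr).
    rewrite /gauss ler_expR !mulNr lerN2 ler_wpM2l// (le_trans (sqn_le_norm _))//.
    by rewrite (le_trans _ nr)// ler_wpM2l ?ler0n// lerXn2r ?nnegrE ?(ltW r0).
  - move=> y fy; have yr1 : r1 < `|y - y1|.
      by rewrite ltNge; apply/negP => /fsign; rewrite leNgt fy.
    rewrite -[leRHS]mul1r ler_pM ?cutoff_ge0 ?cutoff_le1 ?expR_ge0//.
    rewrite ler_expR !mulNr lerN2 ler_wpM2l// (le_trans _ (norm_le_sqn _))//.
    by rewrite lerXn2r ?nnegrE ?(ltW r10)// ltW.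
have ab : a = 2^-1 * expR (c * (3 / 4 * r1 ^+ 2)) * b.
  by rewrite /a /b -mulrA -expRD; congr (_ * expR _); field.
have := expR_ge1Dx (c * (3 / 4 * r1 ^+ 2)).
have -> : c * (3 / 4 * r1 ^+ 2) = 2 * (L + 1) / w.
  by rewrite /c; field; rewrite !gt_eqF.
set X := expR _ => hX.
have {ab} -> : a = 2^-1 * X * b.
  by rewrite ab /X; congr (_ * expR _ * _); rewrite /c; field; rewrite !gt_eqF.
have -> : b + L * b = (L + 1) * b by ring.
rewrite !mulrA ler_pM2r// leNgt => /negP; apply.
have := ler_wpM2l (ltW w0) hX.
have -> : w * (1 + 2 * (L + 1) / w) = w + 2 * (L + 1) by field; rewrite gt_eqF.
lra.
Qed.

End uniqueness.

Section halfspace.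
Context {R : realType} {m : nat}.
Local Notation n := m.+1.
Local Notation E := 'rV[R]_n.

(** [v] stands for the gradient of [phi] at [p0], so [phi <= 0] is locally the side of S turned away
    from [supp f]. *)
Lemma halfspace_uniqueness (f : E -> R) (p0 v : E) (U : set E) (phi : E -> R) :
  Cc f -> open U -> U p0 -> (forall x, U x -> {for x, continuous phi}) ->
  (forall eta, 0 < eta -> exists2 r, 0 < r &
    forall p, `|p - p0| < r -> `|phi p - dot v (p - p0)| <= eta * `|p - p0|) ->
  (forall p, U p -> phi p = 0 -> forall r, 0 < r -> spherical_transform f p r = 0%E) ->
  (forall y, supp f y -> 0 < dot v (y - p0)) -> forall x, f x = 0.
Proof.
move=> ccf oU Up0 cphi dphi RS side x0; apply/eqP/negPn/negP => fx0.
have [cf cK] := ccf; set K := supp f in cK side.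
have [I [L [L0 I_linear I_bound I_van I_lower]]] := @spherical_functional R m f ccf.
have K0 : K !=set0 by exists x0; exact: supp_neq0.
have cdot : continuous (fun y : E => dot v (y - p0)).
  apply: continuous_big => [|i _ x]; first exact: add_continuous.
  apply: (@continuousM _ _ (fun=> v ord0 i) (fun x : E => (x - p0) ord0 i)); first exact: cst_continuous.
  apply: (@continuous_comp _ _ _ (fun x : E => x - p0) (fun x : E => x ord0 i)).
    by apply: continuousB => //; exact: cst_continuous.
  exact: coord_continuous.
have [yc Kyc ycmin] := compact_EVT_min K0 cK (continuous_subspaceT cdot).
have csq := @continuous_sqn_sub R n p0.
have [yD KyD yDmin] := compact_EVT_min K0 cK (continuous_subspaceT csq).
have [yR KyR yRmax] := compact_EVT_max K0 cK (continuous_subspaceT csq).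
rewrite !inE in Kyc KyD KyR.
have [B B0 KB] : exists2 B, 0 <= B & forall y i, K y -> `|y ord0 i| <= B.
  have /compact_bounded/ex_strict_bound_gt0[B B0 /= KB] := cK.
  exists B; first exact: ltW.
  by move=> y i Ky; rewrite (le_trans (le_coord_norm _ _))// ltW// KB.

(* Height and distances of the support *)
pose c1 := dot v (yc - p0).
have c10 : 0 < c1 by exact: side.
have c1_le y : K y -> c1 <= dot v (y - p0) by move=> Ky; apply: ycmin; rewrite inE.
pose D := sqn (yD - p0).
have D_le y : K y -> D <= sqn (y - p0) by move=> Ky; apply: yDmin; rewrite inE.
pose R2 := sqn (yR - p0).
have R2_ge y : K y -> sqn (y - p0) <= R2 by move=> Ky; apply: yRmax; rewrite inE.
pose d0 := enorm (yD - p0).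
have dD : d0 ^+ 2 = D by exact: sqr_enormE.
have dot0 : dot v 0 = 0 :> R by rewrite /dot big1// => i _; rewrite mxE mulr0.
have d00 : 0 < d0.
  rewrite lt0r enorm_ge0 andbT; apply/eqP => /enorm_eq0 yD0.
  by have := side yD KyD; rewrite yD0 dot0 ltxx.
have D0 : 0 < D by rewrite -dD exprn_gt0.
have v0 : 0 < sqn v.
  rewrite lt0r sqn_ge0 andbT; apply/eqP => v0.
  have := cauchy_schwarz v (yc - p0); rewrite enormE v0 sqrtr0 mul0r leNgt.
  by rewrite (side yc Kyc).
have R20 : 0 < R2 by rewrite (lt_le_trans D0)// R2_ge.
pose gap := c1 ^+ 2 / sqn v / R2.
have gap0 : 0 < gap by rewrite !divr_gt0// exprn_gt0.
have gap1 : gap <= 1.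
  have := cauchy_schwarz v (yc - p0); rewrite -/c1 => h.
  have : c1 ^+ 2 <= (enorm v * enorm (yc - p0)) ^+ 2.
    by rewrite lerXn2r ?nnegrE ?(ltW c10)// mulr_ge0 ?enorm_ge0.
  rewrite exprMn !sqr_enormE => h2.
  rewrite /gap ler_pdivrMr// mul1r ler_pdivrMr// (le_trans h2)// mulrC.
  by rewrite ler_wpM2r ?sqn_ge0// R2_ge.
pose th := Num.sqrt (1 - gap).
have thE : th ^+ 2 = 1 - gap by rewrite sqr_sqrtr// subr_ge0.
have th0 : 0 <= th by exact: sqrtr_ge0.
have th1 : th < 1.
  by rewrite -sqrtr1 ltr_sqrt//; lra.
(* Splitting 1 - th into thirds orders three slopes, in units of 2 d0: th + rho = 1 - 2 rho for the
   squared distance, 1 - rho for the barrier, and 1 for the bound |grad Psi|^2 < 4 Psi. *)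
pose rho := (1 - th) / 3.
have rho0 : 0 < rho by rewrite divr_gt0// subr_gt0.
have rhoE : th = 1 - 3 * rho by rewrite /rho; field.
have rho1 : rho <= 1 by lra.
pose eta := rho * d0 * sqn v / c1.
have eta0 : 0 < eta by rewrite divr_gt0// mulr_gt0// mulr_gt0.
have [r1 r10 dphi1] := dphi eta eta0.
have near_norm (q : E) (P : set E) : nbhs q P ->
    exists2 r, 0 < r & forall p, `|p - q| < r -> P p.
  move=> /nbhs_ballP[r /= r0 rP]; exists r => // p pr; apply: rP.
  by rewrite -ball_normE /ball_/= distrC.
have [r2 /= r20 r2U] : exists2 r, 0 < r & forall p, `|p - p0| < r -> U p.
  by apply: near_norm; exact: open_nbhs_nbhs.
(* [r1] serves the expansion of [phi] and [r2] the inclusion in [U]; the third bound keeps d0 delta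
   <= rho D / 12, so that the barrier stays close enough to D on the ball. *)
pose delta := Num.min (Num.min (r1 / 2) (r2 / 2)) (d0 * rho / 12).
have delta0 : 0 < delta by rewrite !lt_min !divr_gt0// mulr_gt0.
have delta1 : delta < r1 by rewrite !gt_min ltr_pdivrMr// ltr_pMr ?ltr1n.
have delta2 : delta < r2 by rewrite !gt_min [X in _ || X || _]ltr_pdivrMr// ltr_pMr ?ltr1n// orbT.
have delta3 : delta <= d0 * rho / 12 by rewrite ge_min lexx orbT.
pose Om : set E := [set p | enorm (p - p0) <= delta /\ phi p <= 0].
have OmU p : enorm (p - p0) <= delta -> U p.
  by move=> pd; apply: r2U; rewrite (le_lt_trans (norm_le_enorm _))// (le_lt_trans pd).
have distK p y : Om p -> K y -> D - 2 * (th + rho) * d0 * enorm (p - p0) <= sqn (y - p).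
  move=> [pd pphi] Ky.
  have -> : y - p = (y - p0) - (p - p0) by rewrite opprB addrA subrK.
  apply: (dist_lower v c1 R2 D d0 th rho) => //.
  - by rewrite rhoE; clear -rho0; lra.
  - have pr1 : `|p - p0| < r1 by rewrite (le_lt_trans (norm_le_enorm _))// (le_lt_trans pd).
    have := dphi1 p pr1; rewrite ler_norml => /andP[h _].
    have : eta * `|p - p0| <= eta * enorm (p - p0).
      by rewrite ler_wpM2l ?norm_le_enorm// ltW.
    rewrite -/eta; move: h pphi; clear; lra.
  - exact: c1_le.
  - exact: R2_ge.
  - exact: D_le.
  - rewrite (le_trans pd)// (le_trans delta3)//.
    have := ler_wpM2l (ltW d00) rho1; lra.

(* Constants of the barrier *)
have rho13 : rho <= 1 / 3 by lra.
have dd : d0 * delta <= D * rho / 12.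
  by have := ler_wpM2l (ltW d00) delta3; rewrite -dD expr2 mulrA mulrA.
(* Up to |p - p0| = delta the cone falls 2 u further than the bound of [distK], so the constant [c0]
   may exceed D by 2 u, less [kap] for the factor exp(kap s). As kap = u / 2 and k mu <= u / 2,
   still Psi p0 >= D + u. *)
pose u := rho * (d0 * delta).
have dd0 : 0 < d0 * delta by exact: mulr_gt0.
have u0 : 0 < u by exact: mulr_gt0.
pose kap := u / 2.
have kap0 : 0 < kap by rewrite divr_gt0.
pose mu := u / (4 * d0).
have mu0 : 0 < mu by rewrite divr_gt0// mulr_gt0.
have muE : d0 * mu = u / 4 by rewrite /mu; field; rewrite gt_eqF.
pose k := 2 * (1 - rho) * d0.
have k0 : 0 <= k by rewrite mulr_ge0 ?(ltW d00)// mulr_ge0//; clear -rho1; lra.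
pose c0 := D + 2 * u - kap.
pose Psi := barrier c0 k mu p0.
have rhoD : 0 < rho * D by exact: mulr_gt0.
(* The first term ensures n < 2 s0 kap, the second makes the Laplacian correction of the barrier at
   most rho D. *)
pose s0 := n%:R / kap + n%:R * k / (mu * (rho * D)) + 1.
have s0a : 0 <= n%:R / kap by rewrite divr_ge0// ltW.
have s0b : 0 <= n%:R * k / (mu * (rho * D)).
  by apply: divr_ge0; [exact: mulr_ge0|apply: mulr_ge0; exact: ltW].
have s00 : 0 < s0 by rewrite /s0; clear -s0a s0b; lra.
have s0kap : n%:R < 2 * s0 * kap.
  have : n%:R / kap < 2 * s0 by rewrite /s0; clear -s0a s0b; lra.
  by rewrite ltr_pdivrMr.
have s0k : n%:R * k / (mu * s0) <= rho * D.
  have mus : 0 < mu * s0 by exact: mulr_gt0.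
  have mur : 0 < mu * (rho * D) by exact: mulr_gt0.
  have : n%:R * k / (mu * (rho * D)) <= s0 by rewrite /s0; clear -s0a; lra.
  by rewrite !ler_pdivrMr//; clear; lra.
have sqrt_ge p : enorm (p - p0) <= Num.sqrt (sqn (p - p0) + mu ^+ 2).
  by rewrite ler_wsqrtr// lerDl sqr_ge0.
have sqrt_le p : Num.sqrt (sqn (p - p0) + mu ^+ 2) <= enorm (p - p0) + mu.
  have h : 0 <= enorm (p - p0) + mu by rewrite addr_ge0 ?enorm_ge0// ltW.
  rewrite -[leRHS](ger0_norm h) -sqrtr_sqr ler_wsqrtr// sqrrD sqr_enormE.
  by rewrite lerD2r lerDl mulrn_wge0// mulr_ge0 ?enorm_ge0// ltW.
have k2 x : 0 <= x -> k * x <= 2 * (d0 * x).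
  move=> x_ge0; have := ler_wpM2r (mulr_ge0 (ltW d00) x_ge0) (_ : 2 * (1 - rho) <= 2).
  by rewrite /k -[2 * (1 - rho) * d0 * x]mulrA; apply; clear -rho0; lra.
have Psi_ge p : enorm (p - p0) <= delta -> D - 2 * (d0 * delta) <= Psi p.
  move=> pd; have := ler_wpM2l k0 (sqrt_le p).
  have := ler_wpM2l (ltW d00) pd; have := k2 _ (enorm_ge0 (p - p0)).
  have := k2 mu (ltW mu0); rewrite mulrDr /Psi /barrier /c0 /kap muE; clear -u0; lra.
have kPsi p : enorm (p - p0) <= delta -> k ^+ 2 + n%:R * k / (mu * s0) <= 4 * Psi p.
  move=> /Psi_ge.
  have -> : k ^+ 2 = 4 * (D - 2 * (rho * D) + rho * (rho * D)) by rewrite /k -dD; ring.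
  have := ler_wpM2r (ltW rhoD) rho13; clear -s0k dd dd0 rhoD D0; lra.
have A_le s p : Om p -> 0 <= s ->
    `|I (gauss s p)| <= L * expR (- s * (D - 2 * (th + rho) * d0 * enorm (p - p0))).
  move=> Op s_ge0; apply: I_bound; [exact: continuous_gauss|exact: expR_ge0|].
  move=> y Ky; rewrite ger0_norm ?expR_ge0// ler_expR !mulNr lerN2 ler_wpM2l//.
  exact: distK.
have dist_pos p : Om p -> kap + D / 2 <= D - 2 * (th + rho) * d0 * enorm (p - p0).
  move=> [pd _]; have h1 := ler_wpM2l (ltW d00) pd.
  have h0 : 0 <= d0 * enorm (p - p0) by rewrite mulr_ge0 ?enorm_ge0// ltW.
  have h2 := ler_wpM2r h0 (_ : 2 * (th + rho) <= 2).
  have {}h2 : 2 * (th + rho) * (d0 * enorm (p - p0)) <= 2 * (d0 * enorm (p - p0)).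
    by apply: h2; clear -rho0 rhoE; lra.
  have h3 : u <= d0 * delta by rewrite /u ger_pMl//; lra.
  have h4 := ler_wpM2l (ltW D0) rho13.
  rewrite -[2 * (th + rho) * d0 * _]mulrA /kap; clear -h1 h0 h2 h3 h4 dd u0 D0; lra.

(* Comparison on the region [Om] *)
have supp0 p : Om p -> f p = 0.
  move=> Op; apply/eqP/negPn/negP => /supp_neq0 Kp.
  have := distK p p Op Kp; rewrite subrr.
  have -> : sqn (0 : E) = 0 by rewrite /sqn big1// => i _; rewrite mxE expr0n.
  have := dist_pos p Op; clear -kap0 D0; lra.
have cOm : compact Om.
  apply: (subclosed_compact _ (compact_norm_ball p0 delta)); last first.
    by move=> p [pd _]; rewrite /= (le_trans (norm_le_enorm _)).
  (* [phi] is continuous on [U] only, so points beyond the closed ball are treated separately,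
     without using [phi]. *)
  rewrite -[Om]setCK; apply: open_closedC; rewrite openE => p /= nOp.
  have [pd|pd] := leP (enorm (p - p0)) delta; last first.
    have : \forall x \near p, delta < enorm (x - p0).
      exact: (cvgr_gt _ (@continuous_enorm_sub R m p0 p) _ pd).
    by apply: filterS => x xd [xd' _]; move: xd; rewrite ltNge xd'.
  have phip : 0 < phi p.
    by rewrite ltNge; apply/negP => phip; apply: nOp.
  have : \forall x \near p, 0 < phi x.
    exact: (cvgr_gt _ (cphi p (OmU p pd)) _ phip).
  by apply: filterS => x phix [_]; rewrite leNgt phix.
have cases p : Om p -> [\/ forall s, I (gauss s p) = 0,
     enorm (p - p0) = delta |
     exists2 d, 0 < d & forall (i : 'I_n) t, `|t| <= d -> Om (p + t *: delta_mx ord0 i)].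
  move=> [pd phip]; have [pe|pe] := eqVneq (enorm (p - p0)) delta; first exact: Or32.
  have [phi0|phi0] := eqVneq (phi p) 0.
    apply: Or31 => s; have Up := OmU p pd.
    rewrite (_ : gauss s p = fun y => expR (- s * enorm (y - p) ^+ 2)).
      by apply: I_van; [exact: supp0|exact: RS].
    by apply/funext => y; rewrite sqr_enormE.
  apply: Or33.
  have : \forall x \near p, enorm (x - p0) < delta /\ phi x < 0.
    apply: filterI.
      have pd' : enorm (p - p0) < delta by rewrite lt_neqAle pe.
      exact: (cvgr_lt _ (@continuous_enorm_sub R m p0 p) _ pd').
    have phip' : phi p < 0 by rewrite lt_neqAle phi0.
    exact: (cvgr_lt _ (cphi p (OmU p pd)) _ phip').
  move=> /nbhs_ballP[r /= r0 rOm]; exists (r / 2); first by rewrite divr_gt0.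
  move=> i t tr; have /rOm[h1 h2] : ball p r (p + t *: delta_mx ord0 i).
    rewrite -ball_normE /ball_/= opprD addrA subrr add0r normrN.
    apply: norm_rV_lt => // j; rewrite !mxE eqxx/= normrM.
    have rr : r / 2 < r by rewrite ltr_pdivrMr// ltr_pMr ?ltr1n.
    apply: le_lt_trans rr; apply: le_trans tr.
    by case: (j == i); rewrite ?normr1 ?mulr1// normr0 mulr0.
  by split; exact: ltW.
(* Stated for a general [J] so that it applies to both [I] and - [I], turning an upper bound into
   one for the absolute value. *)
have max_ineq (J : (E -> R) -> R) :
    (forall (F G : E -> R) a, continuous F -> continuous G ->
       J (fun x => F x + a * G x) = J F + a * J G) ->
    (forall G, `|J G| = `|I G|) ->
    forall p s, Om p -> s0 <= s -> expR (kap * s) * J (gauss s p) <= L * expR (- s * Psi p).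
  move=> J_linear JI.
  have J_bound (G : E -> R) M : continuous G -> 0 <= M ->
      (forall y, K y -> `|G y| <= M) -> `|J G| <= L * M.
    by move=> cG M0 GM; rewrite JI; exact: I_bound.
  have D20 : 0 < D / 2 by rewrite divr_gt0.
  apply: (@maximum_principle R n J L K B L0 J_linear J_bound KB B0 Om kap c0 k mu L s0 L (D / 2) p0) => //.
    move=> p s Op s0s; have s_ge0 : 0 <= s by rewrite (le_trans (ltW s00)).
    rewrite (le_trans (ler_norm _))// JI (le_trans (A_le s p Op s_ge0))//.
    by rewrite ler_wpM2l// ler_expR !mulNr lerN2 ler_wpM2l// dist_pos.
  move=> p Op; have [pd _] := Op; have [J0|pe|dOm] := cases p Op.
  - by apply: Or31 => s _; have := ler_norm (J (gauss s p)); rewrite JI J0 normr0.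
  - apply: Or32 => s s0s; have s_ge0 : 0 <= s by rewrite (le_trans (ltW s00)).
    apply: (@le_trans _ _ (expR (kap * s) * (L * expR (- s * (D - 2 * (th + rho) * d0 * delta))))).
      rewrite ler_wpM2l ?expR_ge0// (le_trans (ler_norm _))// JI.
      by rewrite -[in leRHS]pe A_le.
    rewrite mulrCA ler_wpM2l// -expRD ler_expR.
    have -> : kap * s + - s * (D - 2 * (th + rho) * d0 * delta) =
        - s * (D - 2 * (th + rho) * d0 * delta - kap) by ring.
    rewrite !mulNr lerN2 ler_wpM2l// /Psi /barrier.
    have := ler_wpM2l k0 (sqrt_ge p); rewrite pe /c0 /kap.
    rewrite {1}/k /u; have : th = 1 - 3 * rho by [].
    by move=> ->; clear -dd rho1 rho0 u0; lra.
  - by apply: Or33; split => //; exact: kPsi.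
have A_bound p s : Om p -> s0 <= s -> `|I (gauss s p)| <= L * expR (- s * Psi p).
  move=> Op s0s; have h1 := max_ineq I I_linear (fun=> erefl) p s Op s0s.
  have := max_ineq (fun F => - I F) _ _ p s Op s0s => h2.
  have {}h2 : expR (kap * s) * (- I (gauss s p)) <= L * expR (- s * Psi p).
    apply: h2 => [F G a cF cG|G]; first by rewrite I_linear//; ring.
    by rewrite normrN.
  have e1 : 1 <= expR (kap * s).
    by rewrite -expR0 ler_expR mulr_ge0 ?(ltW kap0)// (le_trans (ltW s00)).
  apply: (@le_trans _ _ (expR (kap * s) * `|I (gauss s p)|)); first by rewrite ler_peMl.
  by case: (ger0P (I (gauss s p))).

(* A centre off S whose ball reaches the support *)
have cPsi : continuous Psi by exact: continuous_barrier.
have Psi0 : D + u <= Psi p0.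
  have := ler_wpM2l k0 (sqrt_le p0); have := k2 mu (ltW mu0).
  have -> : enorm (p0 - p0) = 0 by rewrite subrr enormE /sqn big1 ?sqrtr0// => i _; rewrite mxE expr0n.
  by rewrite add0r muE /Psi /barrier /c0 /kap; clear -u0; lra.
have sqn_sym (x y : E) : sqn (x - y) = sqn (y - x).
  by rewrite -opprB -scaleN1r sqnZ sqrrN expr1n mul1r.
(* Between D + u / 4 and D + u / 2 there is room for localization: the ball of squared radius D + u
   / 4 contains [yD], while the decay rate is above D + u / 2. *)
have [r3 r30 near3] : exists2 r, 0 < r & forall p, `|p - p0| < r ->
    [/\ D + u / 2 < Psi p, sqn (yD - p) < D + u / 4 & enorm (p - p0) < delta].
  have h1 : D + u / 2 < Psi p0 by clear -Psi0 u0; lra.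
  have h2 : sqn (p0 - yD) < D + u / 4 by rewrite sqn_sym -/D; clear -u0; lra.
  have h3 : enorm (p0 - p0) < delta.
    by rewrite subrr enormE /sqn big1 ?sqrtr0// => i _; rewrite mxE expr0n.
  have n1 : \forall p \near p0, D + u / 2 < Psi p.
    exact: (cvgr_gt _ (cPsi p0) _ h1).
  have n2 : \forall p \near p0, sqn (p - yD) < D + u / 4.
    exact: (cvgr_lt _ (@continuous_sqn_sub R n yD p0) _ h2).
  have n3 : \forall p \near p0, enorm (p - p0) < delta.
    exact: (cvgr_lt _ (@continuous_enorm_sub R m p0 p0) _ h3).
  have [r r0 rP] := near_norm _ _ (filterI n1 (filterI n2 n3)).
  exists r => // p pr; have [k1 [k2' k3]] := rP p pr.
  by split=> //; rewrite sqn_sym.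
pose vn := `|v| + 1.
have vn0 : 0 < vn by rewrite ltr_wpDl.
have eta'0 : 0 < sqn v / (2 * vn) by rewrite divr_gt0// mulr_gt0.
have [r4 r40 dphi2] := dphi _ eta'0.
pose tau := Num.min r3 r4 / (2 * vn).
have tau0 : 0 < tau by rewrite divr_gt0 ?mulr_gt0// lt_min r30.
(* Moving off S makes [p1] interior to [Om], so that the barycentres near it remain in [Om]. The
   error in the expansion of [phi] is at most tau |v|^2 / 2 (Euclidean norm), half of the linear
   term, whence phi p1 < 0. *)
pose p1 := p0 - tau *: v.
have p1E : p1 - p0 = - (tau *: v) by rewrite /p1 addrAC subrr add0r.
have tauv : `|p1 - p0| < Num.min r3 r4.
  rewrite p1E normrN normrZ gtr0_norm//.
  have : tau * vn = Num.min r3 r4 / 2 by rewrite /tau; field; rewrite gt_eqF.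
  have : 0 < Num.min r3 r4 by rewrite lt_min r30.
  have := ler_wpM2l (ltW tau0) (_ : `|v| <= vn).
  by rewrite lerDl ler01 => /(_ isT); clear; lra.
have [Psi1 yD1 p1d] : [/\ D + u / 2 < Psi p1, sqn (yD - p1) < D + u / 4 & enorm (p1 - p0) < delta].
  by apply: near3; apply: lt_le_trans tauv _; rewrite ge_min lexx.
have phi1 : phi p1 < 0.
  have := dphi2 p1; rewrite (lt_le_trans tauv) ?ge_min ?lexx ?orbT// => /(_ isT).
  rewrite p1E normrN normrZ gtr0_norm// -scaleNr dotC dotZl dot_self ler_norml => /andP[_].
  have : sqn v / (2 * vn) * (tau * `|v|) <= tau * sqn v / 2.
    have -> : tau * sqn v / 2 = sqn v / (2 * vn) * (tau * vn) by field; rewrite gt_eqF.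
    by rewrite ler_wpM2l ?(ltW eta'0)// ler_wpM2l ?(ltW tau0)// lerDl.
  have : 0 < tau * sqn v by exact: mulr_gt0.
  clear; lra.
have [r5 r50 near5] : exists2 r, 0 < r & forall p, `|p - p1| < r -> Om p /\ D + u / 2 < Psi p.
  have n1 : \forall p \near p1, D + u / 2 < Psi p.
    exact: (cvgr_gt _ (cPsi p1) _ Psi1).
  have n2 : \forall p \near p1, enorm (p - p0) < delta.
    exact: (cvgr_lt _ (@continuous_enorm_sub R m p0 p1) _ p1d).
  have n3 : \forall p \near p1, phi p < 0.
    exact: (cvgr_lt _ (cphi p1 (OmU p1 (ltW p1d))) _ phi1).
  have [r r0 rP] := near_norm _ _ (filterI n1 (filterI n2 n3)).
  exists r => // p pr; have [k1 [k2' k3]] := rP p pr.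
  by split => //; split; exact: ltW.
(* [yD] may be a zero of f; being in the closure of the nonzero set, it has a point [y1] with f y1
   != 0 nearby, still inside the open ball. *)
have [y1 [fy1 /= y1p1]] : [set x | f x != 0] `&` [set y | sqn (y - p1) < D + u / 4] !=set0.
  by apply: KyD; exact: (cvgr_lt _ (@continuous_sqn_sub R n p1 yD) _ yD1).
have [r6 r60 near6] : exists2 r, 0 < r & forall y, `|y - y1| <= r ->
    0 <= f y * f y1 /\ sqn (y - p1) <= D + u / 4.
  have n1 : \forall y \near y1, sqn (y - p1) < D + u / 4.
    exact: (cvgr_lt _ (@continuous_sqn_sub R n p1 y1) _ y1p1).
  have cff : continuous (fun y => f y * f y1).
    by move=> y; apply: (@continuousM _ _ f (fun=> f y1)); [exact: cf|exact: cst_continuous].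
  have ff0 : 0 < f y1 * f y1 by rewrite -expr2 exprn_even_gt0.
  have n2 : \forall y \near y1, 0 < f y * f y1.
    exact: (cvgr_gt _ (cff y1) _ ff0).
  have [r r0 rP] := near_norm _ _ (filterI n1 n2).
  exists (r / 2); first by rewrite divr_gt0.
  move=> y yr; have [|k1 k2'] := rP y.
    by rewrite (le_lt_trans yr)// ltr_pdivrMr// ltr_pMr// ltr1n.
  by split; exact: ltW.
apply: (@nonvanishing_contradiction R m I L (D + u / 4) r6 f p1 y1 L0 r60).
- by move=> r r0; exact: I_lower.
- by move=> y /near6[].
- by move=> y /near6[].
move=> c e c_ge0 e0.
(* For s >= s2 the barycentre [p2], at distance c |y1 - p1| / (s + c) from [p1], lies within [r5] of
   it, where the decay rate is known. *)
pose s2 := s0 + c * `|y1 - p1| / r5.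
apply: (@localization R n I L K I_linear I_bound (D + u / 4) (D + u / 2) c L s2 p1 y1) => //.
  by clear -u0; lra.
move=> s s2s.
have s0s : s0 <= s by rewrite (le_trans _ s2s)// lerDl divr_ge0 ?mulr_ge0// ltW.
have s_gt0 : 0 < s by rewrite (lt_le_trans s00).
have sc0 : 0 < s + c by rewrite ltr_pwDl.
pose p2 := p1 + (c / (s + c)) *: (y1 - p1).
(* A product of two Gaussians is a Gaussian centred at the barycentre. *)
have prodE y : gauss s p1 y * gauss c y1 y =
    expR (- (s * c / (s + c) * sqn (y1 - p1))) * gauss (s + c) p2 y.
  rewrite /gauss -!expRD; congr expR; rewrite /sqn !mulr_sumr -sumrN -!big_split/=.
  apply: eq_bigr => i _; rewrite /p2 !mxE; field.
  by rewrite gt_eqF.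
have [|Op2 Psi2] := near5 p2.
  rewrite /p2 addrAC subrr add0r normrZ ger0_norm ?divr_ge0 ?(ltW sc0)//.
  rewrite mulrAC ltr_pdivrMr//.
  have : c * `|y1 - p1| / r5 < s + c by move: s2s; rewrite /s2; clear -s00 c_ge0; lra.
  by rewrite ltr_pdivrMr// [r5 * _]mulrC.
have -> : (fun y => gauss s p1 y * gauss c y1 y) =
   (fun y => expR (- (s * c / (s + c) * sqn (y1 - p1))) * gauss (s + c) p2 y).
  by apply/funext => y; rewrite prodE.
rewrite (I_scale I I_linear); last exact: continuous_gauss.
rewrite normrM ger0_norm ?expR_ge0//.
apply: (@le_trans _ _ (`|I (gauss (s + c) p2)|)).
  rewrite ler_piMl// -[leRHS]expR0 ler_expR oppr_le0 mulr_ge0 ?sqn_ge0//.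
  by rewrite divr_ge0 ?mulr_ge0 ?(ltW s_gt0) ?(ltW sc0).
apply: (le_trans (A_bound p2 (s + c) Op2 _)); first by rewrite (le_trans s0s)// lerDl.
rewrite ler_wpM2l// ler_expR !mulNr lerN2.
apply: (@le_trans _ _ (s * Psi p2)); first by rewrite ler_wpM2l// ltW.
by rewrite ler_wpM2r ?lerDl//; clear -c_ge0 s_gt0 Psi2 D0 u0; lra.
Qed.
End halfspace.

Theorem theorem18 (R : realType) (n : nat) (S : set 'rV[R]_n)
    (f : 'rV[R]_n -> R) :
  C1_hypersurface S -> Cc f -> RS_vanishes S f ->
  (exists p0, S p0 /\ strictly_one_side S p0 (supp f)) ->
  forall x, f x = 0.
Proof.
move=> _ ccf RS [p0 [Sp0 [U [phi [[oU Up0 [dphi _] SU reg] side]]]]].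
have phi0 : phi p0 = 0.
  by have [] : [set x | U x /\ phi x = 0] p0 by rewrite -SU.
(* In dimension 0 the only vector is zero, which contradicts the nonvanishing differential. *)
case: n => [|m] in S f ccf RS p0 Sp0 U phi oU Up0 dphi SU reg side phi0 *.
  have [v] := reg p0 Up0 phi0.
  by rewrite (_ : v = 0) ?linear0 ?eqxx//; apply/rowP => -[].
have RS0 p : U p -> phi p = 0 -> forall r, 0 < r -> spherical_transform f p r = 0%E.
  move=> Up phip r r0; apply: RS => //.
  by have [] : (S `&` U) p by rewrite SU.
have cphi x : U x -> {for x, continuous phi}.
  by move=> Ux; exact: differentiable_continuous (dphi x Ux).
pose v : 'rV[R]_m.+1 := \row_i 'd phi p0 (delta_mx ord0 i).
have dE x : 'd phi p0 x = dot v x.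
  rewrite [in LHS](row_sum_delta x) linear_sum/=; apply: eq_bigr => i _.
  by rewrite linearZ/= /v mxE [RHS]mulrC.
have expand eta : 0 < eta -> exists2 r, 0 < r &
    forall p, `|p - p0| < r -> `|phi p - dot v (p - p0)| <= eta * `|p - p0|.
  move=> eta0.
  have /eqaddoP/(_ _ eta0) := diff_locally (dphi p0 Up0).
  move=> /nbhs_ballP[r /= r0 rP]; exists r => // p pr.
  have := rP (p - p0); rewrite -ball_normE /ball_/= sub0r normrN => /(_ pr).
  by rewrite !fctE/= subrK phi0 add0r dE.
case: side => side.
  apply: (@halfspace_uniqueness R m f p0 v U phi ccf oU Up0 cphi expand RS0).
  by move=> y /side /=; rewrite dE.
(* The other side is reduced to the first by changing the sign of the defining function. *)
apply: (@halfspace_uniqueness R m f p0 (- v) U (fun x => - phi x) ccf oU Up0).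
- by move=> x Ux; apply: continuousN; exact: cphi.
- move=> eta /expand[r r0 h]; exists r => // p /h.
  have -> : dot (- v) (p - p0) = - dot v (p - p0) by rewrite -scaleN1r dotZl mulN1r.
  by rewrite -opprD normrN.
- by move=> p Up /eqP; rewrite oppr_eq0 => /eqP; exact: RS0.
- move=> y /side /=; rewrite dE -[- v]scaleN1r dotZl mulN1r oppr_gt0.
  exact.
Qed.
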